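(* Let $\mathbb{P}_{\mathbf{\Sigma}}$ be the proper smooth two-dimensional toric Deligne–Mumford stack associated to a complete stacky fan $\mathbf{\Sigma}=(\Sigma,\{v_i\}_{i=1}^n)$ in a lattice $N\cong\mathbb{Z}^2$. Then there are infinitely many (isomorphism classes of) $\mathrm{H}$-trivial line bundles on $\mathbb{P}_{\mathbf{\Sigma}}$ if and only if there exists $\{i,j\}\subset\{1,2,\dots,n\}$ with $i\ne j$ such that $v_i$ and $v_j$ are collinear.
   Context: Setting: $N\cong\mathbb{Z}^2$ is a lattice, $N^*=\mathrm{Hom}(N,\mathbb{Z})$, and $\Sigma$ is a complete simplicial fan in $N$ with $n$ one-dimensional cones. A stacky fan $\mathbf{\Sigma}=(\Sigma,\{v_i\}_{i=1}^n)$ consists of $\Sigma$ together with a choice of a nonzero lattice point $v_i\in N$ (not necessarily primitive) in each one-dimensional cone of $\Sigma$. Two vectors $v_i,v_j$ with $i\neq j$ are collinear if they lie on a common line through the origin; since they span distinct rays this means $v_j=-c\,v_i$ for some $c>0$. The stack: let $G=\{(\zeta_1,\dots,\zeta_n)\in(\mathbb{C}^* )^n \mid \prod_{i=1}^n\zeta_i^{w\cdot v_i}=1\text{ for all } w\in N^*\}$, and let $U\subset\mathbb{C}^n$ be the open set of points $(x_1,\dots,x_n)$ such that some cone of $\Sigma$ contains all $v_i$ with $x_i=0$. $G$ acts on $U$ coordinatewise, and $\mathbb{P}_{\mathbf{\Sigma}}=[U/G]$. Line bundles: for $(r_1,\dots,r_n)\in\mathbb{Z}^n$, $\mathcal{O}(\sum_i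 r_iE_i)$ is the line bundle on $\mathbb{P}_{\mathbf{\Sigma}}$ given by the trivial line bundle $\mathbb{C}\times U\to U$ with $G$-linearization $((\zeta_i),t,(x_i))\mapsto(t\prod_i\zeta_i^{r_i},(\zeta_ix_i))$. All line bundles arise this way, and $\mathrm{Pic}(\mathbb{P}_{\mathbf{\Sigma}})$ is the quotient of $\mathbb{Z}^n$ (basis $E_1,\dots,E_n$) by the subgroup of elements $\sum_i (w\cdot v_i)E_i$, $w\in N^*$. A line bundle $\mathcal{L}$ on $\mathbb{P}_{\mathbf{\Sigma}}$ is called $\mathrm{H}$-trivial if $\mathrm{H}^j(\mathbb{P}_{\mathbf{\Sigma}},\mathcal{L})=0$ for all $j\ge 0$. *)

(* Defs.v *)
From HB Require Import structures.
From mathcomp Require Import all_boot all_order all_algebra.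
From mathcomp Require Import boolp classical_sets functions cardinality reals.
From mathcomp Require Import complex mpoly.

Set Implicit Arguments.
Unset Strict Implicit.
Unset Printing Implicit Defensive.

Import Order.TTheory GRing.Theory Num.Theory.
Local Open Scope ring_scope.

(* The lattice N is Z^2, N_R is R^2, and 'I_n indexes the one-dimensional cones.
   A cone of a simplicial fan is encoded by the set s of (indices of) its
   one-dimensional faces; the cone itself is [cone R (ray S) s] below. *)
Record stacky_fan (n : nat) := StackyFan {
  fan : {set {set 'I_n}};
  ray : 'I_n -> 'rV[int]_2
}.

Definition toR (R : realType) (v : 'rV[int]_2) : 'rV[R]_2 :=
  map_mx (fun m : int => m%:~R) v.

Definition cone (R : realType) n (v : 'I_n -> 'rV[int]_2) (s : {set 'I_n}) :
    set 'rV[R]_2 :=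
  [set x | exists c : 'I_n -> R,
     (forall i, 0 <= c i) /\ x = \sum_(i in s) c i *: toR R (v i)]%classic.
Arguments cone R {n} v s.

(* Faces of the simplicial cone on s are the cones on the subsets of s, and two
   cones of a fan meet along a common face, necessarily the one on s :&: t.
   Applied to singletons, the axioms also say that the v_i are nonzero and span
   pairwise distinct rays. *)
Record complete_stacky_fan (R : realType) n (S : stacky_fan n) : Prop := {
  fan_ray : forall i, ([set i] \in fan S)%SET;
  fan_face : forall s t : {set 'I_n}, s \in fan S -> t \subset s -> t \in fan S;
  fan_simplicial : forall s : {set 'I_n}, s \in fan S -> forall c : 'I_n -> R,
    \sum_(i in s) c i *: toR R (ray S i) = 0 -> forall i, i \in s -> c i = 0;
  fan_meet : forall s t : {set 'I_n}, s \in fan S -> t \in fan S ->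
    (cone R (ray S) s `&` cone R (ray S) t)%classic
      = cone R (ray S) (s :&: t)%SET;
  fan_complete : forall x : 'rV[R]_2,
    exists2 s, s \in fan S & cone R (ray S) s x
}.

Definition collinear (R : realType) (v w : 'rV[int]_2) : Prop :=
  exists u : 'rV[R]_2, u != 0 /\
    exists a b : R, toR R v = a *: u /\ toR R w = b *: u.

Definition point (R : realType) n := 'I_n -> R[i].

Definition stackG (R : realType) n (S : stacky_fan n) : set (point R n) :=
  [set z | (forall i, z i != 0) /\
     forall w : {additive 'rV[int]_2 -> int}, \prod_i z i ^ w (ray S i) = 1]%classic.

Definition stackU (R : realType) n (S : stacky_fan n) : set (point R n) :=
  [set x | exists2 s, s \in fan S &
     forall i, x i = 0 -> cone R (ray S) s (toR R (ray S i))]%classic.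

Definition act (R : realType) n (z x : point R n) : point R n :=
  fun i => z i * x i.

Definition chart (R : realType) n (s : {set 'I_n}) : set (point R n) :=
  [set x | forall i, i \notin s -> x i != 0]%classic.

Definition maximal_cone n (S : stacky_fan n) :=
  {s : {set 'I_n} | maxset (fun t => t \in fan S) s}.

Lemma stackU_cover (R : realType) n (S : stacky_fan n) :
  complete_stacky_fan R S -> forall x : point R n,
  stackU S x <-> exists s : maximal_cone S, chart (val s) x.
Proof.
move=> hS x; split.
- case=> s sS hx; have [m hm sm] := maxset_exists (P := fun t => t \in fan S) sS.
  exists (exist _ m hm) => i /= im; apply/eqP => xi0.
  have ci : cone R (ray S) [set i]%SET (toR R (ray S i)).
    by exists (fun=> 1); split=> [k|]; rewrite ?ler01 // big_set1 scale1r.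
  have := conj ci (hx i xi0).
  rewrite -[_ /\ _]/((cone R (ray S) [set i]%SET `&` cone R (ray S) s)%classic _).
  rewrite (fan_meet hS (fan_ray hS i) sS).
  have -> : ([set i] :&: s = finset.set0)%SET.
    apply/setP=> k; rewrite !inE; case: eqP => //= ->.
    by apply: contraNF im => /(fintype.subsetP sm).
  case=> c [_]; rewrite big_set0 => vi0.
  have h1 : \sum_(k in [set i]%SET) (1 : R) *: toR R (ray S k) = 0.
    by rewrite big_set1 scale1r.
  have := fan_simplicial hS (fan_ray hS i) (c := fun=> 1) h1 (i := i) (set11 i).
  by move/eqP; rewrite oner_eq0.
- case=> -[s hs] /= hx; exists s; first exact: maxsetp hs.
  move=> i xi0; have si : i \in s by apply: contraTT isT => /hx; rewrite xi0 eqxx.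
  exists (fun k => (k == i)%:R); split=> [k|]; first exact: ler0n.
  rewrite (bigD1 i) //= eqxx scale1r big1 ?addr0 // => k /andP[_ /negPf ->].
  by rewrite scale0r.
Qed.

(* The chart of s is the principal open subset of C^n where the product h of
   the x_i, i \notin s, does not vanish; its regular functions are p / h^k. *)
Definition regular_on (R : realType) n (s : {set 'I_n}) (f : point R n -> R[i]) :
    Prop :=
  exists (p : {mpoly R[i][n]}) (k : nat), forall x, chart s x ->
    f x * (\prod_(i | i \notin s) x i) ^+ k = p.@[x].

(* The sections of O(sum_i r_i E_i) over [chart s / G]: x |-> (f x, x) is
   invariant for the linearization (z, t, x) |-> (t prod_i z_i^(r_i), z x).
   The values of f outside of the chart are irrelevant. *)
Definition section (R : realType) n (S : stacky_fan n) (r : 'rV[int]_n)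
    (s : {set 'I_n}) (f : point R n -> R[i]) : Prop :=
  regular_on s f /\
  forall z x, stackG S z -> chart s x ->
    f (act z x) = f x * \prod_i z i ^ r ord0 i.

(* Cech complex of the line bundle O(sum_i r_i E_i) for the open cover of [U/G]
   by the [chart s / G], s a maximal cone.  Cochains of degree j are indexed by
   all (j+1)-tuples of maximal cones, and the intersection of the charts of the
   t k is the chart of the intersection of the t k.  These intersections are
   quotients of affine varieties by a diagonalizable group, so they have no
   higher quasi-coherent cohomology and this complex computes H^j([U/G], L). *)
Definition cochain_type (R : realType) n (S : stacky_fan n) (j : nat) :=
  {ffun 'I_j.+1 -> maximal_cone S} -> point R n -> R[i].

Definition overlap n (S : stacky_fan n) j (t : {ffun 'I_j.+1 -> maximal_cone S}) :
    {set 'I_n} :=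
  (\bigcap_(k < j.+1) val (t k))%SET.

Definition cochain (R : realType) n (S : stacky_fan n) (r : 'rV[int]_n) j
    (f : cochain_type R S j) : Prop :=
  forall t, section S r (overlap t) (f t).

Definition cochain_eq (R : realType) n (S : stacky_fan n) j
    (f g : cochain_type R S j) : Prop :=
  forall t x, chart (overlap t) x -> f t x = g t x.

Definition cech_diff (R : realType) n (S : stacky_fan n) j
    (f : cochain_type R S j) : cochain_type R S j.+1 :=
  fun t x => \sum_(k < j.+2) (-1) ^+ k * f [ffun l => t (lift k l)] x.

Definition cocycle (R : realType) n (S : stacky_fan n) (r : 'rV[int]_n) j
    (f : cochain_type R S j) : Prop :=
  cochain r f /\ cochain_eq (cech_diff f) (fun _ _ => 0).

Definition coboundary (R : realType) n (S : stacky_fan n) (r : 'rV[int]_n) j :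
    cochain_type R S j -> Prop :=
  match j with
  | 0 => fun f => cochain_eq f (fun _ _ => 0)
  | j'.+1 => fun f => exists2 g : cochain_type R S j',
      cochain r g & cochain_eq f (cech_diff g)
  end.

Definition cohomology_vanishes (R : realType) n (S : stacky_fan n)
    (r : 'rV[int]_n) (j : nat) : Prop :=
  forall f : cochain_type R S j, cocycle r f -> coboundary r f.

Definition H_trivial (R : realType) n (S : stacky_fan n) (r : 'rV[int]_n) : Prop :=
  forall j, cohomology_vanishes R S r j.

(* The class of O(sum_i r_i E_i) in Pic, as a coset in Z^n. *)
Definition pic_class n (S : stacky_fan n) (r : 'rV[int]_n) : set 'rV[int]_n :=
  [set r' | exists w : {additive 'rV[int]_2 -> int},
     r' = r + \row_i w (ray S i)]%classic.

(* Main.v *)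
Require Import Defs.
From HB Require Import structures.
From mathcomp Require Import all_boot all_order all_algebra.
From mathcomp Require Import boolp reals.
From mathcomp Require Import ring zify.

Set Implicit Arguments.
Unset Strict Implicit.
Unset Printing Implicit Defensive.

Import Order.TTheory GRing.Theory Num.Theory.
Local Open Scope ring_scope.

(* A line bundle of class r decomposes over the exponents m in the class of r:
   the degree-m part of the Cech complex depends only on the set of rays where
   m is negative, and it is acyclic exactly when this set is a proper nonempty
   arc of the cycle of rays, i.e. has exactly one exit (a ray in the set whose
   counterclockwise successor is not).

   If v_i and v_j are opposite, then -E_i is H-trivial, and so are all its
   translates by multiples of det(v_i, -) applied to the rays on one side of the
   line: on each side the sign pattern is that of a linear form, while exactly
   one of m_i, m_j is negative.

   If no two rays are collinear, move m along the direction keeping m_i fixed.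
   All other coordinates are then nonconstant, so most positions are far from
   zero in every coordinate but m_i.  At such a position where the two neighbours
   of i have the same sign, making m_i change sign changes the number of exits,
   so H-triviality fails.  Hence the range of positions where the neighbours have
   the same sign is short: r bends by a bounded amount at every ray, which leaves
   finitely many classes. *)

(** * Cech complexes of a finite cover *)

Section CechComplex.
Variables (F : comNzRingType) (C : eqType).

Definition tuples j := {ffun 'I_j.+1 -> C}.

Definition face j (t : tuples j.+1) (k : 'I_j.+2) : tuples j :=
  [ffun l => t (lift k l)].

Definition diff j (c : tuples j -> F) (t : tuples j.+1) : F :=
  \sum_(k < j.+2) (-1) ^+ k * c (face t k).

(** Prepending a fixed vertex is the standard contracting homotopy of a full simplex. *)
Definition prepend (x : C) j (t : tuples j) : tuples j.+1 :=
  [ffun l => oapp t x (unlift ord0 l)].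

Definition vertex (x : C) : tuples 0 := [ffun => x].

Lemma prepend0 x j (t : tuples j) : prepend x t ord0 = x.
Proof. by rewrite ffunE unlift_none. Qed.

Lemma prependS x j (t : tuples j) k : prepend x t (lift ord0 k) = t k.
Proof. by rewrite ffunE liftK. Qed.

Lemma face_prepend0 x j (t : tuples j) : face (prepend x t) ord0 = t.
Proof. by apply/ffunP=> l; rewrite ffunE prependS. Qed.

Lemma face_prependS x j (t : tuples j.+1) k :
  face (prepend x t) (lift ord0 k) = prepend x (face t k).
Proof.
apply/ffunP=> l; rewrite ffunE; case: (unliftP ord0 l) => [l'|] ->.
  have -> : lift (lift ord0 k) (lift ord0 l') = lift ord0 (lift k l').
    by apply: val_inj; rewrite /= /bump /= !add1n ltnS addnS.
  by rewrite !prependS ffunE.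
have -> : lift (lift ord0 k) ord0 = ord0 :> 'I_j.+3 by apply: val_inj.
by rewrite !prepend0.
Qed.

Lemma face_vertex x y k :
  face (prepend x (vertex y)) k = vertex (if k == ord0 then y else x).
Proof.
apply/ffunP=> l; rewrite [l]ord1 !ffunE.
case: (unliftP ord0 k) => [k'|] ->; last first.
  by rewrite -[X in unlift _ X]/(lift ord0 ord0) liftK /= ffunE.
rewrite (_ : lift (lift ord0 k') ord0 = ord0); last by apply: val_inj.
by rewrite unlift_none.
Qed.

Lemma tuple0E (t : tuples 0) : t = vertex (t ord0).
Proof. by apply/ffunP=> l; rewrite [l]ord1 ffunE. Qed.

Lemma tupleSE j (t : tuples j.+1) : t = prepend (t ord0) (face t ord0).
Proof.
by apply/ffunP=> l; case: (unliftP ord0 l) => [l'|] ->; rewrite ?prependS ?prepend0 ?ffunE.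
Qed.

Lemma diff_prepend0 (c : tuples 0 -> F) x y :
  diff c (prepend x (vertex y)) = c (vertex y) - c (vertex x).
Proof.
rewrite /diff big_ord_recl big_ord1 !face_vertex eqxx eq_sym (negPf (neq_lift _ _)).
by rewrite expr0 expr1 mul1r mulN1r.
Qed.

(** The homotopy formula: face 0 of [prepend x t] is [t], and the other faces keep [x] in front with
    the sign shifted by one. *)
Lemma diff_prepend j (c : tuples j.+1 -> F) x (t : tuples j.+1) :
  diff c (prepend x t) = c t - diff (fun u => c (prepend x u)) t.
Proof.
rewrite /diff big_ord_recl face_prepend0 expr0 mul1r -sumrN; congr (_ + _).
apply: eq_bigr => k _; rewrite face_prependS /= /bump leq0n add1n exprS.
by rewrite mulN1r mulNr.
Qed.

Lemma eq_diff j (c e : tuples j -> F) (t : tuples j.+1) :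
  (forall k, c (face t k) = e (face t k)) -> diff c t = diff e t.
Proof. by move=> ce; apply: eq_bigr => k _; rewrite ce. Qed.

Lemma diffB j (c e : tuples j -> F) t :
  diff (fun u => c u - e u) t = diff c t - diff e t.
Proof. by rewrite /diff -sumrB; apply: eq_bigr => k _; rewrite mulrBr. Qed.

(** Splitting off the first vertex twice with the homotopy formula cancels everything but the double
    differential of a cochain of lower degree, so induction applies. *)
Lemma diff_diff j (c : tuples j -> F) t : diff (diff c) t = 0.
Proof.
elim: j c t => [|j IHj] c t; rewrite [t]tupleSE diff_prepend.
  set u := face t ord0; rewrite [u]tupleSE [face u ord0]tuple0E.
  rewrite [X in _ - X](eq_diff (e := fun v => c v - c (vertex (t ord0)))); last first.
    by move=> k; rewrite [face _ k]tuple0E; exact: diff_prepend0.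
  by rewrite !diff_prepend0; ring.
rewrite [X in _ - X](eq_diff (e := fun v => c v - diff (fun w => c (prepend (t ord0) w)) v)).
  by rewrite diffB IHj subr0 subrr.
by move=> k; exact: diff_prepend.
Qed.

Variables (I : finType) (inc : C -> {set I}).
Implicit Type N : {set I}.

Definition hits N j (t : tuples j) := exists2 i, i \in N & forall k, i \in inc (t k).

(** The tuples hit by [N] are stable under faces. The cochains vanishing on them are the cochains of
    the full simplex relative to that subcomplex. *)
Definition avoids N j (c : tuples j -> F) := forall t, hits N t -> c t = 0.

Definition closed_cochain j (c : tuples j -> F) := forall t, diff c t = 0.

Definition exact_cochain N j : (tuples j -> F) -> Prop :=
  match j with
  | 0 => fun c => forall t, c t = 0
  | j'.+1 => fun c => exists2 b : tuples j' -> F,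
      avoids N b & forall t, c t = diff b t
  end.

(** Vanishing of all relative cohomology: the subcomplex of hit tuples has the cohomology of a
    point. *)
Definition acyclic N := forall j (c : tuples j -> F),
  avoids N c -> closed_cochain c -> exact_cochain N c.

(** Prepending [x] sends hit tuples to hit tuples, so the contraction of the full simplex restricts
    to the relative complex. *)
Lemma acyclic1 (x : C) i : i \in inc x -> acyclic [set i].
Proof.
move=> ix j c cN dc.
have hit_x (t : tuples j) : hits [set i] t -> hits [set i] (prepend x t).
  case=> i' /set1P -> it; exists i; first exact: set11.
  by move=> k; case: (unliftP ord0 k) => [k'|] ->; rewrite ?prependS ?prepend0.
case: j c cN dc hit_x => [|j] c cN dc hit_x /=.
  move=> t; have := dc (prepend x t).
  rewrite [t]tuple0E diff_prepend0 (cN (vertex x)) ?subr0 //.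
  by exists i => [|k]; rewrite ?set11 // ffunE.
exists (fun u => c (prepend x u)).
  move=> t [i' /set1P -> it]; apply: cN; exists i; first exact: set11.
  by move=> k; case: (unliftP ord0 k) => [k'|] ->; rewrite ?prependS ?prepend0.
by move=> t; have /eqP := dc (prepend x t); rewrite diff_prepend subr_eq0 => /eqP.
Qed.

(* The tuples hit by [l] form a full simplex, which meets those hit by [N] in
   the vertex [x] only. *)
Lemma acyclicU1 N l (x : C) y : acyclic N ->
  l \in inc x -> y \in N -> y \in inc x ->
  (forall z, l \in inc z -> z != x -> [disjoint inc z & N]) ->
  acyclic (l |: N).
Proof.
move=> acN lx yN yx only_x j c cN dc.
have cN' : avoids N c.
  by move=> t [i iN it]; apply: cN; exists i; rewrite // inE iN orbT.
have hit_x j' (t : tuples j') :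
    (forall k, l \in inc (t k)) -> hits (l |: N) (prepend x t).
  move=> lt; exists l; first exact: setU11.
  by move=> k; case: (unliftP ord0 k) => [k'|] ->; rewrite ?prependS ?prepend0.
have := acN j c cN' dc; case: j c cN dc cN' => // -[|j] c cN dc cN' [b bN cb] /=.
  (* In degree one [b] needs no correction: [c] vanishes on the pair of [x] and a vertex hit by [l],
     so [b] takes there the same value as at [x], which is zero because [x] is hit by [y]. *)
  exists b => // t [i + it]; rewrite inE => /orP[/set1P il|iN]; last first.
    by apply: bN; exists i.
  have := cb (prepend x t); rewrite cN; last by apply: hit_x; rewrite -il.
  rewrite [t]tuple0E diff_prepend0 (bN (vertex x)) ?subr0 //.
  by exists y => // k; rewrite ffunE.
(* On the simplex of tuples hit by [l], [c] vanishes, so [b] is closed there and [h] is its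
   primitive by contraction onto [x]. Subtracting [diff h] makes [b] vanish on this simplex. On a
   tuple hit by [N], a face hit by [l] is constant at [x], where [h] is zero. *)
pose h (t : tuples j) := if [forall k, l \in inc (t k)] then b (prepend x t) else 0.
exists (fun t => b t - diff h t); last first.
  by move=> t; rewrite diffB diff_diff subr0.
move=> t [i + it]; rewrite inE => /orP[/set1P il|iN].
  rewrite {i}il in it *.
  rewrite (eq_diff (e := fun u => b (prepend x u))); last first.
    by move=> k; rewrite /h ifT //; apply/forallP=> k'; rewrite ffunE.
  by rewrite -diff_prepend -cb cN //; exact: hit_x.
rewrite bN ?sub0r; last by exists i.
apply/eqP; rewrite oppr_eq0; apply/eqP/big1 => k _; rewrite /h.
case: forallP => [lt|_]; last by rewrite mulr0.
have tx k' : face t k k' = x.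
  apply/eqP; apply: contraTT (iN) => /(only_x _ (lt k')) /disjointFr -> //.
  by rewrite ffunE.
rewrite bN ?mulr0 //; exists i => // k'.
case: (unliftP ord0 k') => [k''|] ->; rewrite ?prependS ?prepend0 //.
  by rewrite ffunE.
by rewrite -(tx ord0) ffunE.
Qed.

Variable x0 : C.

(** No tuple is hit by the empty set, and the constant cochain 1 is a nonzero class of degree 0. *)
Lemma not_acyclic0 : ~ acyclic set0.
Proof.
move=> /(_ 0%N (fun=> 1)) H.
suff: (1 : F) = 0 by move/eqP; rewrite oner_eq0.
apply: (H _ _ (vertex x0)) => [t [i]|t]; first by rewrite inE.
by rewrite [t]tupleSE [face t _]tuple0E diff_prepend0 subrr.
Qed.

(** The indicator [u] of the piece inside [A] is constant on each piece of the hit subcomplex, so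
    [diff u] is a relative cocycle. A relative primitive would vanish at [x] and [y], whereas [u]
    differs between them. *)
Lemma not_acyclic_split N A (x y : C) :
  (forall z i i', i \in inc z -> i' \in inc z -> i \in N :&: A -> i' \in N ->
     i' \in A) ->
  ~~ [disjoint inc x & N :&: A] -> ~~ [disjoint inc y & N :\: A] -> ~ acyclic N.
Proof.
move=> sepA; rewrite -!setI_eq0 => /set0Pn[i] /setIP[ix iNA].
move=> /set0Pn[i'] /setIP[iy] /setDP[i'N i'A].
pose u (t : tuples 0) : F := (~~ [disjoint inc (t ord0) & N :&: A])%:R.
have uP z : u (vertex z) = (~~ [disjoint inc z & N :&: A])%:R.
  by rewrite /u ffunE.
have uN (t : tuples 1) : hits N t -> diff u t = 0.
  case=> a aN at_; rewrite [t]tupleSE [face t ord0]tuple0E diff_prepend0 !uP.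
  have e z : a \in inc z -> ~~ [disjoint inc z & N :&: A] = (a \in A).
    move=> az; apply/idP/idP=> [|aA]; last first.
      by rewrite -setI_eq0; apply/set0Pn; exists a; rewrite !inE az aN aA.
    rewrite -setI_eq0 => /set0Pn[b] /setIP[bz bNA].
    exact: sepA bz az bNA aN.
  by rewrite !e ?subrr // ?ffunE; exact: at_.
move=> /(_ 1%N (diff u) uN (diff_diff u)) /= [b bN ub].
have := ub (prepend x (vertex y)); rewrite !diff_prepend0.
rewrite (bN (vertex x)); last first.
  by exists i => [|k]; rewrite ?ffunE //; case/setIP: iNA.
rewrite (bN (vertex y)); last by exists i' => // k; rewrite ffunE.
rewrite !uP.
have -> : [disjoint inc y & N :&: A].
  rewrite -setI_eq0; apply/eqP/setP=> a; rewrite !inE; apply/negP.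
  move=> /and3P[ay aN aA]; move: i'A; rewrite (sepA y a i') //.
  by rewrite inE aN.
have -> : ~~ [disjoint inc x & N :&: A].
  by rewrite -setI_eq0; apply/set0Pn; exists i; rewrite !inE ix; case/setIP: iNA => -> ->.
by rewrite subrr sub0r => /eqP; rewrite oppr_eq0 oner_eq0.
Qed.

End CechComplex.

(** * Covers whose cones form a cycle *)

Section CyclicNerve.
Variables (F : numFieldType) (C : eqType) (I : finType) (inc : C -> {set I}).
Variables (nxt : I -> I) (sig : I -> C).
Hypothesis nxt_inj : injective nxt.
Hypothesis nxt2_neq : forall i, nxt (nxt i) != i.
Hypothesis nxt_connected : forall N : {set I},
  {in N, forall i, nxt i \in N} -> N != set0 -> N = [set: I].
Hypothesis inc_sig : forall i, inc (sig i) = [set i; nxt i].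
Hypothesis sig_surj : forall x, exists i, x = sig i.
Implicit Type N : {set I}.

Definition exits N := [set l in N | nxt l \notin N].

Lemma nxt_neq i : nxt i != i.
Proof. by apply/eqP=> e; have := nxt2_neq i; rewrite !e eqxx. Qed.

Lemma sig_inj : injective sig.
Proof.
move=> i j /(congr1 inc); rewrite !inc_sig => /setP e.
have := e i; rewrite !inE eqxx /= => /esym/orP[/eqP //|/eqP ij].
have := e (nxt i); rewrite !inE eqxx orbT => /esym/orP[|/eqP/nxt_inj //].
by rewrite ij (negPf (nxt2_neq _)).
Qed.

Lemma exits_nonempty N : N != set0 -> N != [set: I] -> exits N != set0.
Proof.
move=> N0 NT; apply/eqP=> eN; case/eqP: NT; apply: nxt_connected => // i iN.
by apply: contraT => niN; move/setP/(_ i): eN; rewrite !inE iN niN.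
Qed.

(** Induction on the length of the arc. Without its exit [l], the arc ends at the predecessor [p] of
    [l], and [sig p] is the only cone through [l] that meets the rest, so [acyclicU1] puts [l]
    back. *)
Lemma one_exit_acyclic N : #|exits N| = 1%N -> acyclic F inc N.
Proof.
have [m] := ubnP #|N|; elim: m N => // m IHm N; rewrite ltnS => Nm.
move=> /eqP/cards1P[l eN]; have /setIdP[lN nlN] : l \in exits N by rewrite eN set11.
have [N0|N0] := eqVneq (N :\ l) set0.
  have -> : N = [set l].
    by apply/eqP; rewrite eqEsubset sub1set lN andbT -setD_eq0 N0.
  by apply: (@acyclic1 _ _ _ _ (sig l)); rewrite inc_sig !inE eqxx.
have /set0Pn[p] : exits (N :\ l) != set0.
  by apply: exits_nonempty => //; apply/eqP=> /setP/(_ l); rewrite !inE eqxx.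
have exP q : q \in exits (N :\ l) -> nxt q = l.
  rewrite !inE => /andP[/andP[ql qN]]; rewrite negb_and negbK => /orP[/eqP //|nqN].
  by case/eqP: ql; apply/set1P; rewrite -eN inE qN.
move=> pE; have pl := exP p pE; have /setIdP[pN _] := pE.
have e1 : exits (N :\ l) = [set p].
  apply/setP=> q; rewrite inE; apply/idP/eqP => [/exP ql|-> //].
  by apply: nxt_inj; rewrite ql.
rewrite -(setD1K lN); apply: (@acyclicU1 _ _ _ _ _ _ (sig p) p) => //.
- apply: IHm; last by rewrite e1 cards1.
  by apply: leq_trans Nm; rewrite [ltnRHS](cardsD1 l) lN.
- by rewrite inc_sig !inE pl eqxx orbT.
- by rewrite inc_sig !inE eqxx.
move=> z; have [q ->] := sig_surj z; rewrite inc_sig !inE => /orP[/eqP <-|/eqP lq].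
  move=> _; rewrite -setI_eq0; apply/eqP/setP=> a; rewrite !inE.
  have [->|_] //= := eqVneq a l.
  by have [->|] //= := eqVneq a (nxt l); rewrite (negPf nlN).
by rewrite (nxt_inj (etrans pl lq)) eqxx.
Qed.

(* The cochain [h] winds once around the cycle of cones. *)
Lemma not_acyclicT (i0 : I) : ~ acyclic F inc [set: I].
Proof.
pose s x := odflt i0 [pick i | sig i == x].
have sK i : s (sig i) = i.
  by rewrite /s; case: pickP => [j /eqP/sig_inj //|/(_ i)]; rewrite eqxx.
have Ks x : sig (s x) = x by have [i ->] := sig_surj x; rewrite sK.
pose e i j : F := (j == nxt i)%:R - (i == nxt j)%:R.
pose h (t : tuples C 1) := e (s (t ord0)) (s (t (lift ord0 ord0))).
have hE x y : h (prepend x (vertex y)) = e (s x) (s y).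
  by rewrite /h prependS prepend0 ffunE.
have eN i j : e i j = - e j i by rewrite /e opprB.
have e0 i : e i i = 0 by rewrite /e subrr.
have dh x y z : diff h (prepend x (prepend y (vertex z))) =
    e (s y) (s z) - e (s x) (s z) + e (s x) (s y).
  rewrite diff_prepend hE; set w := diff _ _.
  have -> : w = e (s x) (s z) - e (s x) (s y) by rewrite /w diff_prepend0 !hE.
  by rewrite opprB addrA addrAC.
have hT : avoids inc [set: I] (diff h).
  move=> t [a _ at_]; rewrite [t]tupleSE; set u := face t ord0.
  have au k : a \in inc (u k) by rewrite ffunE.
  rewrite [u]tupleSE [face u ord0]tuple0E dh.
  have : a \in inc (face u ord0 ord0) by rewrite ffunE.
  move: (at_ ord0) (au ord0); set x := t ord0; set y := u ord0; set z := face _ _ _.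
  (* Only two cones contain the ray [a], told apart by whether [s w] is [a]. Hence two of the three
     cones [x], [y], [z] coincide, and the antisymmetry of [e] makes the sum vanish. *)
  have sE w w' : a \in inc w -> a \in inc w' ->
      (s w == a) = (s w' == a) -> s w = s w'.
    rewrite -{1}(Ks w) -{1}(Ks w') !inc_sig !inE ![a == _]eq_sym.
    have [->|_] /= := eqVneq (s w) a; first by move=> _ _ /esym/eqP.
    by have [//|_] /= := eqVneq (s w') a => /eqP <- /eqP/nxt_inj.
  move=> /[dup] ax /sE xE /[dup] ay /sE yE az.
  have [->|xy] := eqVneq (s x) (s y); first by rewrite e0 subrr addr0.
  have [->|yz] := eqVneq (s y) (s z); first by rewrite e0 sub0r addNr.
  have [->|xz] := eqVneq (s x) (s z); first by rewrite e0 subr0 eN addNr.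
  case E1: (s x == a); case E2: (s y == a); case E3: (s z == a);
    first [ by case/eqP: xy; apply: xE; rewrite ?E1 ?E2
          | by case/eqP: yz; apply: yE; rewrite ?E2 ?E3
          | by case/eqP: xz; apply: xE; rewrite ?E1 ?E3 ].
move=> /(_ 2%N (diff h) hT (diff_diff h)) /= [g gT dhg].
pose f t := h t - g t.
have df t : diff f t = 0 by rewrite diffB dhg subrr.
(* [u] is a potential of the closed cochain [f]. As [g] vanishes on adjacent cones, [u] grows by one
   along each step of [nxt], which is impossible on a finite cycle: sum over all rays. *)
pose u i := f (prepend (sig i0) (vertex (sig i))).
have u_nxt i : u (nxt i) = u i + 1.
  have := df (prepend (sig i0) (prepend (sig i) (vertex (sig (nxt i))))).
  rewrite diff_prepend diff_prepend0 -/(u _) -/(u i) /f hE !sK /e eqxx.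
  rewrite gT; last first.
    exists (nxt i) => // k; case: (unliftP ord0 k) => [k'|] ->.
      by rewrite prependS ffunE inc_sig !inE eqxx.
    by rewrite prepend0 inc_sig !inE eqxx orbT.
  rewrite [i == _]eq_sym (negPf (nxt2_neq i)) !subr0 => /eqP.
  by rewrite subr_eq0 eq_sym subr_eq => /eqP ->; rewrite addrC.
have : \sum_i u i = \sum_i u i + #|I|%:R.
  rewrite {1}(reindex_inj nxt_inj) /= (eq_bigr _ (fun i _ => u_nxt i)) big_split /=.
  by rewrite sumr_const.
move/eqP; rewrite -subr_eq0 opprD addrA subrr sub0r oppr_eq0 pnatr_eq0 => /eqP I0.
by have := max_card (pred1 i0); rewrite I0 card1.
Qed.

(** [A] collects the rays from which [l1] is reached by [nxt] without leaving [N]. Neighbours in [N]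
    are both in [A] or both outside, and [l2] is outside since no step inside [N] starts from it; so
    [A] splits [N]. *)
Lemma not_acyclic_exits N l1 l2 :
  l1 \in exits N -> l2 \in exits N -> l1 != l2 -> ~ acyclic F inc N.
Proof.
move=> /setIdP[l1N nl1] /setIdP[l2N nl2] l12.
pose r := [rel x y | [&& y == nxt x, x \in N & y \in N]].
pose A := [set x | connect r x l1].
have l1A : l1 \in A by rewrite inE connect0.
have l2A : l2 \notin A.
  rewrite inE; apply/connectP=> -[[|y p] /=]; first by move=> _ /eqP; rewrite (negPf l12).
  by case/andP=> /and3P[/eqP ->]; rewrite (negPf nl2).
have AP x : x \in N -> nxt x \in N -> (x \in A) = (nxt x \in A).
  move=> xN nxN; rewrite !inE; apply/idP/idP=> [|h].
    case/connectP=> -[/= _ e|y p /= /andP[/and3P[/eqP -> _ _] rp] e].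
      by move: nl1; rewrite e nxN.
    by apply/connectP; exists p.
  by apply: connect_trans h; apply: connect1; rewrite /= eqxx xN.
apply: (@not_acyclic_split _ _ _ _ _ A (sig l1) (sig l2)).
- move=> z i i'; have [q ->] := sig_surj z; rewrite inc_sig.
  by move=> /set2P[]-> /set2P[]-> /setIP[iN iA] i'N //; [rewrite -AP | rewrite AP].
- by rewrite -setI_eq0; apply/set0Pn; exists l1; rewrite inc_sig !inE eqxx l1N connect0.
rewrite -setI_eq0; apply/set0Pn; exists l2.
by move: l2A; rewrite inc_sig !inE eqxx l2N => ->.
Qed.

Lemma acyclicP N : inhabited I -> acyclic F inc N <-> #|exits N| = 1%N.
Proof.
case=> i0; split=> [acN|]; last exact: one_exit_acyclic.
have N0 : N != set0.
  by apply/eqP=> N0; apply: (@not_acyclic0 F _ _ inc (sig i0)); rewrite -N0.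
have NT : N != [set: I] by apply/eqP=> NT; apply: (@not_acyclicT i0); rewrite -NT.
have /set0Pn[l lE] := exits_nonempty N0 NT.
apply/eqP/cards1P; exists l; apply/setP=> l'; rewrite inE.
apply/idP/eqP=> [l'E|-> //]; apply/eqP; apply: contraPT acN.
exact: not_acyclic_exits.
Qed.

End CyclicNerve.

(** * Plane geometry of the fan *)

Definition det2 (K : comPzRingType) (v w : 'rV[K]_2) : K :=
  v 0 0 * w 0 1 - v 0 1 * w 0 0.

Definition dot2 (K : comPzRingType) (v w : 'rV[K]_2) : K :=
  v 0 0 * w 0 0 + v 0 1 * w 0 1.

Section PlaneVectors.
Variable K : comPzRingType.
Implicit Types u v w x : 'rV[K]_2.

Lemma rv2P v w : v 0 0 = w 0 0 -> v 0 1 = w 0 1 -> v = w.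
Proof.
move=> e0 e1; apply/rowP=> -[[|[|//]] i].
  by rewrite (_ : Ordinal i = 0) //; apply: val_inj.
by rewrite (_ : Ordinal i = 1) //; apply: val_inj.
Qed.

Lemma det2_antisym v w : det2 v w = - det2 w v.
Proof. by rewrite /det2; ring. Qed.

Lemma det2vv v : det2 v v = 0.
Proof. by rewrite /det2; ring. Qed.

Lemma det2_antipodal (a b : K) w u v :
  a *: u + b *: v = 0 -> a * det2 u w + b * det2 v w = 0.
Proof.
move=> uv; transitivity (det2 (a *: u + b *: v) w); first by rewrite /det2 !mxE; ring.
by rewrite uv /det2 !mxE !mul0r subrr.
Qed.

Lemma cramer u v w : det2 v w *: u + det2 w u *: v + det2 u v *: w = 0.
Proof. by apply: rv2P; rewrite !mxE /det2; ring. Qed.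

Lemma cramer_between u v w : det2 u w *: v = det2 v w *: u + det2 u v *: w.
Proof. by apply: rv2P; rewrite !mxE /det2; ring. Qed.

(** For [v] and [w] on the left of [u], this reduces the sign of [det2 v w] to a comparison of the
    cotangents of their angles from [u]. *)
Lemma det2_dot2 u v w :
  det2 v w * dot2 u u = dot2 u v * det2 u w - det2 u v * dot2 u w.
Proof. by rewrite /det2 /dot2; ring. Qed.

Lemma dot2_lagrange u v :
  dot2 u u * dot2 v v = det2 u v ^+ 2 + dot2 u v ^+ 2.
Proof. by rewrite /det2 /dot2; ring. Qed.

Lemma det2_eq0_scale u v : det2 u v = 0 -> dot2 v v *: u = dot2 u v *: v.
Proof.
move=> d0; apply: rv2P; rewrite !mxE; apply/eqP; rewrite -subr_eq0; apply/eqP.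
  by transitivity (det2 u v * v 0 1); [rewrite /det2 /dot2; ring | rewrite d0 mul0r].
by transitivity (- det2 u v * v 0 0); [rewrite /det2 /dot2; ring | rewrite d0 oppr0 mul0r].
Qed.

End PlaneVectors.

Lemma dot2_gt0 (K : realDomainType) (u : 'rV[K]_2) : (0 < dot2 u u) = (u != 0).
Proof.
rewrite /dot2 -!expr2 lt0r addr_ge0 ?sqr_ge0 // andbT; congr (~~ _).
rewrite paddr_eq0 ?sqr_ge0 // !sqrf_eq0; apply/andP/eqP.
  move=> [/eqP e0 /eqP e1].

  by apply: rv2P; rewrite mxE.
by move=> ->; rewrite !mxE.
Qed.

Lemma det2_toR (R : realType) (v w : 'rV[int]_2) :
  det2 (toR R v) (toR R w) = (det2 v w)%:~R.
Proof. by rewrite /det2 !mxE -!intrM -intrB. Qed.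

Lemma dot2_toR (R : realType) (v w : 'rV[int]_2) :
  dot2 (toR R v) (toR R w) = (dot2 v w)%:~R.
Proof. by rewrite /dot2 !mxE -!intrM -intrD. Qed.

(** * Extremal vectors of an open half-plane *)

Section HalfPlane.
Variables (I : finType) (v : I -> 'rV[int]_2).
Variables (u : 'rV[int]_2) (P : pred I).
Hypothesis u_P : forall k, P k -> 0 < det2 u (v k).

(** The cotangent of the angle from [u] to [v k], which decreases counterclockwise over the
    half-plane. *)
Let key k : rat := (dot2 u (v k))%:Q / (det2 u (v k))%:Q.

Let key_det2 k l : P k -> P l -> (0 <= det2 (v k) (v l)) = (key l <= key k).
Proof.
move=> Pk Pl; have u0 : 0 < dot2 u u.
  by rewrite dot2_gt0; apply/eqP=> u0; have := u_P Pk; rewrite u0 /det2 !mxE !mul0r subrr ltxx.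
rewrite -(pmulr_lge0 _ u0) det2_dot2 subr_ge0 /key ler_pdivrMr ?ltr0z ?u_P //.
by rewrite mulrAC ler_pdivlMr ?ltr0z ?u_P // -!intrM ler_int mulrC [leRHS]mulrC.
Qed.

Lemma first_in_half_plane k0 : P k0 ->
  exists2 k, P k & forall l, P l -> 0 <= det2 (v k) (v l).
Proof.
move=> Pk0; case: (arg_maxP key Pk0) => k Pk kmax.
by exists k => // l Pl; rewrite key_det2 //; exact: kmax.
Qed.

Lemma last_in_half_plane k0 : P k0 ->
  exists2 k, P k & forall l, P l -> 0 <= det2 (v l) (v k).
Proof.
move=> Pk0; case: (arg_minP key Pk0) => k Pk kmin.
by exists k => // l Pl; rewrite key_det2 //; exact: kmin.
Qed.

End HalfPlane.

(** * The counterclockwise order of the rays *)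

Section CyclicOrder.
Variables (I : finType) (v : I -> 'rV[int]_2) (nxt : I -> I).
Local Notation D i j := (det2 (v i) (v j)).
Hypothesis v_inj : forall i j, D i j = 0 -> 0 < dot2 (v i) (v j) -> i = j.
Hypothesis det_nxt : forall i, 0 < D i (nxt i).
Hypothesis nxt_min : forall i k, 0 < D i k -> 0 <= D (nxt i) k.

Lemma ray_neq0 i : v i != 0.
Proof.
apply/eqP=> vi0; have := det_nxt i.
by rewrite vi0 /det2 !mxE !mul0r subrr ltxx.
Qed.

(** Parallel vectors on one side of the line of [v k] have a positive scalar product, by
    [det2_dot2]. *)
Lemma same_side i j k : D i j = 0 -> 0 < D i k -> 0 < D j k -> i = j.
Proof.
move=> ij ik jk; apply: (v_inj ij).
have := det2_dot2 (v i) (v j) (v k); rewrite ij mul0r subr0.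
have i0 : 0 < dot2 (v i) (v i) by rewrite dot2_gt0 ray_neq0.
by move=> e; have := mulr_gt0 jk i0; rewrite e pmulr_lgt0.
Qed.

Lemma nxt_det_inj : injective nxt.
Proof.
move=> i j e; have [ij|ji|ij] := ltgtP (D i j) 0.
- have := nxt_min (i := j) (k := i); rewrite -e [D j i]det2_antisym oppr_gt0.
  move=> /(_ ij); rewrite det2_antisym oppr_ge0 leNgt det_nxt //.
- have := nxt_min ji; rewrite e det2_antisym oppr_ge0 leNgt det_nxt //.
by apply: (same_side ij (det_nxt i)); rewrite e det_nxt.
Qed.

Lemma nxt2_det_neq i : nxt (nxt i) != i.
Proof.
apply/eqP=> e; have := det_nxt (nxt i).
by rewrite e det2_antisym oppr_gt0 ltNge ltW // det_nxt.
Qed.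

(** [nxt] has a single cycle; this serves as an induction principle along the rays. A ray [p]
    outside [N] is compared with the members of [N] on each side of it. *)
Lemma nxt_det_connected (N : {set I}) :
  {in N, forall i, nxt i \in N} -> N != set0 -> N = [set: I].
Proof.
move=> Nnxt /set0Pn[l0 l0N]; apply/setP=> p; rewrite inE; apply: contraT => pN.
(* Among the members of [N] with [p] on their left, take the last one [k]. Its successor does not
   jump over [p], so it is [p] itself or a later such member, both impossible. *)
have noA l : l \in N -> D l p <= 0.
  move=> lN; rewrite leNgt; apply/negP=> lp.
  pose P := [pred l | (l \in N) && (0 < D l p)].
  have uP k : P k -> 0 < det2 (- v p) (v k).
    have -> : det2 (- v p) (v k) = D k p by rewrite /det2 !mxE; ring.
    by case/andP.
  have Pl : P l by rewrite /= lN.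
  have [k /andP[kN kp] kmax] := last_in_half_plane uP Pl.
  have := kmax (nxt k); rewrite /= Nnxt //= [D (nxt k) k]det2_antisym oppr_ge0.
  rewrite [_ <= 0]leNgt det_nxt /=; have := nxt_min kp; rewrite le_eqVlt => /orP[|-> /(_ isT) //].
  move=> /eqP/esym nkp _; case/negP: pN.
  suff <- : nxt k = p by exact: Nnxt.
  apply: v_inj => //.
  have := det2_dot2 (v (nxt k)) (v k) (v p); rewrite nkp mulr0 sub0r.
  have k0 : 0 < dot2 (v (nxt k)) (v (nxt k)) by rewrite dot2_gt0 ray_neq0.
  move=> e; have := mulr_gt0 kp k0; rewrite e -mulNr -det2_antisym.
  by rewrite pmulr_rgt0.
(* A member of [N] parallel to [p] would be opposite to it, and its successor would have [p] on its
   left. *)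
have noB l : l \in N -> D l p < 0.
  move=> lN; rewrite lt_neqAle noA // andbT; apply/eqP=> lp.
  have := noA _ (Nnxt _ lN); rewrite leNgt => /negP; apply.
  have l_0 : 0 < dot2 (v l) (v l) by rewrite dot2_gt0 ray_neq0.
  have dlp : dot2 (v l) (v p) < 0.
    rewrite ltNge le_eqVlt; apply/negP=> /orP[/eqP e|/(v_inj lp) e]; last first.
      by rewrite e (negPf pN) in lN.
    have := dot2_gt0 (v p); rewrite ray_neq0 => p0.
    have := dot2_lagrange (v l) (v p).
    by rewrite lp -e !expr0n addr0 => e0; have := mulr_gt0 l_0 p0; rewrite e0 ltxx.
  rewrite -(pmulr_lgt0 _ l_0) det2_dot2 lp mulr0 sub0r -mulrN pmulr_rgt0 ?det_nxt //.
  by rewrite oppr_gt0.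
(* All of [N] now lies in the open half-plane left of [p], and the last member there has a successor
   beyond it. *)
have uP k : k \in N -> 0 < D p k by move/noB; rewrite det2_antisym oppr_lt0.
have [k kN kmax] := last_in_half_plane uP l0N.
have := kmax _ (Nnxt _ kN).
by rewrite det2_antisym oppr_ge0 leNgt det_nxt.
Qed.

End CyclicOrder.

(** * Maximal cones of a complete fan in the plane *)

Section FanGeometry.
Variables (R : realType) (n : nat) (S : stacky_fan n).
Hypothesis hS : complete_stacky_fan R S.
Local Notation v i := (toR R (ray S i)).
Local Notation D i j := (det2 (v i) (v j)).
Local Notation dz i j := (det2 (ray S i) (ray S j)).
Implicit Types (s : {set 'I_n}) (x y : 'rV[R]_2).

Lemma cone_gen s k : k \in s -> cone R (ray S) s (v k).
Proof.
move=> sk; exists (fun l => (l == k)%:R); split=> [l|]; first exact: ler0n.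
rewrite (bigD1 k) //= eqxx scale1r big1 ?addr0 // => l /andP[_ /negPf ->].
by rewrite scale0r.
Qed.

Lemma cone_comb s (a b : R) x y : 0 <= a -> 0 <= b ->
  cone R (ray S) s x -> cone R (ray S) s y -> cone R (ray S) s (a *: x + b *: y).
Proof.
move=> a0 b0 [c [c0 ->]] [d [d0 ->]]; exists (fun i => a * c i + b * d i).
split=> [i|]; first by rewrite addr_ge0 ?mulr_ge0.
rewrite !scaler_sumr -big_split; apply: eq_bigr => i _ /=.
by rewrite !scalerA scalerDl.
Qed.

Lemma fan_ray_neq0 i : v i != 0.
Proof.
apply/eqP=> vi0; have := fan_simplicial hS (fan_ray hS i) (c := fun=> 1).
rewrite big_set1 vi0 scaler0 => /(_ erefl i (set11 i)) /eqP.
by rewrite oner_eq0.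
Qed.

(** The cones on [s] and on the ray [i] meet in the cone on their common indices, which is zero if
    [i] is not in [s], whereas [v i] is nonzero. *)
Lemma cone_ray s i : s \in fan S -> cone R (ray S) s (v i) -> i \in s.
Proof.
move=> sS vis; have := conj (cone_gen (set11 i)) vis.
rewrite -[_ /\ _]/(classical_sets.setI (cone R (ray S) [set i]) (cone R (ray S) s) _).
rewrite (fan_meet hS (fan_ray hS i) sS) => -[c [_ e]].
apply: contraT => si; case/negP: (fan_ray_neq0 i); rewrite e big1 // => k.
by rewrite !inE => /andP[/eqP ->]; rewrite (negPf si).
Qed.

Lemma ray_inj i j : D i j = 0 -> 0 < dot2 (v i) (v j) -> i = j.
Proof.
move=> ij dij; suff : i \in [set j] by move/set1P.
apply: cone_ray; first exact: (fan_ray hS j).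
have j0 : 0 < dot2 (v j) (v j) by rewrite dot2_gt0 fan_ray_neq0.
have -> : v i = (dot2 (v i) (v j) / dot2 (v j) (v j)) *: v j + 0 *: v j.
  rewrite scale0r addr0; apply: (scalerI (lt0r_neq0 j0)).
  by rewrite scalerA mulrCA divff ?lt0r_neq0 // mulr1 det2_eq0_scale.
by apply: cone_comb (cone_gen (set11 j)) (cone_gen (set11 j)); rewrite // divr_ge0 // ltW.
Qed.

Lemma fan_det_neq0 s a b : s \in fan S -> a \in s -> b \in s -> a != b -> D a b != 0.
Proof.
move=> sS sa sb ab; apply/eqP=> d0.
pose c k : R := if k == a then dot2 (v b) (v b) else if k == b then - dot2 (v a) (v b) else 0.
have := fan_simplicial hS sS (c := c); rewrite (bigD1 a) //= (bigD1 b) /=; last first.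
  by rewrite sb eq_sym.
rewrite big1 => [|k /andP[/andP[_ ka] kb]]; last first.
  by rewrite /c (negPf ka) (negPf kb) scale0r.
rewrite /c !eqxx [b == a]eq_sym (negPf ab) addr0 => /(_ _ a sa); rewrite eqxx => H.
suff /H /eqP : dot2 (v b) (v b) *: v a + (- dot2 (v a) (v b)) *: v b = 0.
  by apply/negP; rewrite gt_eqF // dot2_gt0 fan_ray_neq0.
by rewrite det2_eq0_scale // scaleNr subrr.
Qed.

(** A third index [k] would give the Cramer relation between three generators, with the nonzero
    coefficient [D a b] at [k]. *)
Lemma fan_subset2 s a b : s \in fan S -> a \in s -> b \in s -> a != b ->
  s = [set a; b].
Proof.
move=> sS sa sb ab; apply/eqP; rewrite eqEsubset subUset !sub1set sa sb !andbT.
apply/fintype.subsetP=> k sk; rewrite !inE; apply: contraT.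
rewrite negb_or => /andP[ka kb].
pose c l := if l == a then D b k else if l == b then D k a else if l == k then D a b else 0.
have := fan_simplicial hS sS (c := c); rewrite (bigD1 a) //= (bigD1 b) /=; last first.
  by rewrite sb eq_sym.
rewrite (bigD1 k) /=; last by rewrite sk ka kb.
rewrite big1 => [|l /andP[/andP[/andP[_ la] lb] lk]]; last first.
  by rewrite /c (negPf la) (negPf lb) (negPf lk) scale0r.
rewrite /c !eqxx [b == a]eq_sym (negPf ab) (negPf ka) (negPf kb) addr0 addrA cramer.
move=> /(_ erefl k sk) /eqP; rewrite (negPf ka) (negPf kb) ?eqxx => /eqP d0.
by have := fan_det_neq0 sS sa sb ab; rewrite d0 eqxx.
Qed.

Lemma cone_between s x y i : cone R (ray S) s x -> cone R (ray S) s y ->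
  0 < det2 x y -> 0 <= det2 x (v i) -> 0 <= det2 (v i) y -> cone R (ray S) s (v i).
Proof.
move=> sx sy xy xi iy.
have -> : v i = (det2 (v i) y / det2 x y) *: x + (det2 x (v i) / det2 x y) *: y.
  apply: (scalerI (lt0r_neq0 xy)).
  rewrite scalerDr !scalerA ![det2 x y * (_ / _)]mulrCA divff ?lt0r_neq0 // !mulr1.
  exact: cramer_between.
by apply: cone_comb sx sy; rewrite divr_ge0 // ltW.
Qed.

Lemma det2_suml u s (c : 'I_n -> R) :
  det2 u (\sum_(k in s) c k *: v k) = \sum_(k in s) c k * det2 u (v k).
Proof.
by rewrite /det2 !summxE !mulr_sumr -sumrB; apply: eq_bigr => k _; rewrite !mxE; ring.
Qed.

Lemma dot2_suml u s (c : 'I_n -> R) :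
  dot2 u (\sum_(k in s) c k *: v k) = \sum_(k in s) c k * dot2 u (v k).
Proof.
by rewrite /dot2 !summxE !mulr_sumr -big_split; apply: eq_bigr => k _; rewrite !mxE /=; ring.
Qed.

Lemma exists_left i : exists k, 0 < D i k.
Proof.
(* [x] is [v i] after a quarter turn; some generator of a cone containing it lies to the left of
   [v i]. *)
pose x : 'rV[R]_2 := \row_j (if j == 0 then - v i 0 1 else v i 0 0).
have ix : 0 < det2 (v i) x.
  have -> : det2 (v i) x = dot2 (v i) (v i) by rewrite /det2 /dot2 !mxE /=; ring.
  by rewrite dot2_gt0 fan_ray_neq0.
have [s sS [c [c0 xE]]] := fan_complete hS x.
apply/existsP; apply: contraLR ix; rewrite negb_exists => /forallP noleft.
by rewrite -leNgt xE det2_suml sumr_le0 // => k _; rewrite mulr_ge0_le0 // leNgt.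
Qed.

Lemma exists_nxt i : exists j, 0 < dz i j /\ forall k, 0 < dz i k -> 0 <= dz j k.
Proof.
have [k0 k0P] := exists_left i; rewrite det2_toR ltr0z in k0P.
pose P := [pred k | 0 < dz i k]; have uP k : P k -> 0 < dz i k by [].
by have [j jP jmin] := first_in_half_plane uP k0P; exists j.
Qed.

(** A cone [s] containing [v i + v j] has generators [p] and [q] strictly on either side of this
    vector [x]. No ray lies strictly between [i] and [j], so [v i] lies between [v p] and [x], and
    [v j] between [x] and [v q]; both are in the cone, hence [i] and [j] are in [s]. *)
Lemma adjacent_fan i j : 0 < dz i j -> (forall k, 0 < dz i k -> 0 <= dz j k) ->
  [set i; j] \in fan S.
Proof.
move=> ij' jmin'; have ij : 0 < D i j by rewrite det2_toR ltr0z.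
have jmin k : 0 < D i k -> 0 <= D j k by rewrite !det2_toR ltr0z ler0z; exact: jmin'.
pose x := v i + v j.
have ix : det2 (v i) x = D i j by rewrite /det2 !mxE; ring.
have xj : det2 x (v j) = D i j by rewrite /det2 !mxE; ring.
have xD k : det2 x (v k) = D i k + D j k by rewrite /det2 !mxE; ring.
have xx : 0 < dot2 x x.
  rewrite dot2_gt0; apply: contraTneq ij => x0.
  by rewrite -ix x0 /det2 !mxE !mulr0 subrr ltxx.
have [s sS sx] := fan_complete hS x; have [c [c0 xE]] := sx.
have dx : \sum_(k in s) c k * det2 x (v k) = 0 by rewrite -det2_suml -xE det2vv.
(* Otherwise all generators used by [x] are parallel to it, and one in the direction of [x] would be
   a ray strictly between [i] and [j]. *)
have [k sk ck] : exists2 k, k \in s & c k * det2 x (v k) != 0.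
  apply/exists_inP; apply: contraLR (xx); rewrite negb_exists_in => /forall_inP none.
  rewrite -leNgt [X in dot2 _ X]xE dot2_suml sumr_le0 // => k sk.
  have := none k sk; rewrite negbK mulf_eq0 => /orP[/eqP ->|/eqP xk]; first by rewrite mul0r.
  rewrite mulr_ge0_le0 // leNgt; apply/negP=> dk.
  have ik : 0 < D i k.
    have e : D i k * dot2 x x = dot2 x (v k) * det2 (v i) x + dot2 x (v i) * det2 x (v k).
      by rewrite /det2 /dot2; ring.
    by rewrite -(pmulr_lgt0 _ xx) e xk mulr0 addr0 ix mulr_gt0.
  have jk : 0 < D k j.
    have e : D k j * dot2 x x = dot2 x (v k) * det2 x (v j) - dot2 x (v j) * det2 x (v k).
      by rewrite /det2 /dot2; ring.
    by rewrite -(pmulr_lgt0 _ xx) e xk mulr0 subr0 xj mulr_gt0.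
  by have := jmin k ik; rewrite det2_antisym oppr_ge0 leNgt jk.
have sumlt (f : 'I_n -> R) : (forall l, l \in s -> 0 <= f l) -> f k != 0 ->
    k \in s -> \sum_(l in s) f l != 0.
  move=> f0 fk sk'; rewrite psumr_neq0 //; apply/hasP; exists k; first by rewrite mem_index_enum.
  by rewrite sk' lt0r fk f0.
have [p sp px] : exists2 p, p \in s & det2 x (v p) < 0.
  apply/exists_inP; apply: contraPT dx; rewrite negb_exists_in => /forall_inP none.
  apply/eqP; apply: sumlt => // l sl; rewrite mulr_ge0 // leNgt; exact: none.
have [q sq xq] : exists2 q, q \in s & 0 < det2 x (v q).
  apply/exists_inP; apply: contraPT dx; rewrite negb_exists_in => /forall_inP none.
  apply/eqP; rewrite -oppr_eq0 -sumrN; apply: sumlt; rewrite ?oppr_eq0 // => l sl.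
  by rewrite -mulrN mulr_ge0 // oppr_ge0 leNgt; exact: none.
apply: (fan_face hS sS); rewrite subUset !sub1set; apply/andP; split.
  apply: (cone_ray sS); apply: (cone_between (cone_gen sp) sx).
  - by rewrite det2_antisym oppr_gt0.
  - rewrite det2_antisym oppr_ge0 leNgt; apply/negP=> ip; have jp := jmin p ip.
    by move: px; rewrite xD ltNge addr_ge0 // ltW.
  - by rewrite ix ltW.
apply: (cone_ray sS); apply: (cone_between sx (cone_gen sq)) => //.
  by rewrite xj ltW.
have [iq|iq] := ltP 0 (D i q); first exact: jmin.
by apply/ltW; apply: lt_le_trans xq _; rewrite xD gerDr.
Qed.

Lemma fan_nonempty : inhabited 'I_n.
Proof.
have [t _ [c [_ e]]] := fan_complete hS (\row_j 1).
have [i|none] := pickP [pred i : 'I_n | true]; first by [].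
move/rowP/(_ 0): e; rewrite big1 => [|k]; last by have := none k.
by rewrite !mxE => /eqP; rewrite oner_eq0.
Qed.

Lemma fan_cyclic_order : exists nxt : 'I_n -> 'I_n,
  [/\ forall i, 0 < dz i (nxt i), forall i k, 0 < dz i k -> 0 <= dz (nxt i) k
   & forall s, maxset (fun t => t \in fan S) s <-> exists i, s = [set i; nxt i]].
Proof.
have [nxt nxtP] := fin_all_exists exists_nxt.
exists nxt; split=> [i|i|s]; [by case: (nxtP i)..|].
have nxt_fan i : [set i; nxt i] \in fan S by case: (nxtP i) => *; apply: adjacent_fan.
have nxt_neq i : i != nxt i.
  by apply/eqP=> e; case: (nxtP i); rewrite -e det2vv ltxx.
split=> [/maxsetP[sS smax]|[i ->]]; last first.
  apply/maxsetP; split=> // t tS; rewrite subUset !sub1set => /andP[ti tn].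
  exact: (fan_subset2 tS ti tn (nxt_neq i)).
have [i0] := fan_nonempty.
have [s0|/set0Pn[a sa]] := eqVneq s set0.
  have := smax _ (fan_ray hS i0); rewrite s0 sub0set => /(_ isT)/setP/(_ i0).
  by rewrite !inE eqxx.
have [sE|] := boolP (s \subset [set a]).
  exists a; apply/esym/smax => //; apply: subset_trans sE _.
  by rewrite sub1set !inE eqxx.
case/fintype.subsetPn => b sb; rewrite inE => ba.
(* The successor of [c] lies between [c] and [d], hence in the cone, so it belongs to [s], which has
   only two elements. *)
have pos c d : c \in s -> d \in s -> 0 < D c d -> s = [set c; nxt c].
  move=> sc sd cd; have [cn nmin] := nxtP c.
  apply: (fan_subset2 sS sc _ (nxt_neq c)).
  apply: (cone_ray sS); apply: (cone_between (cone_gen sc) (cone_gen sd) cd).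
    by rewrite det2_toR ler0z ltW.
  by move: cd; rewrite !det2_toR ltr0z ler0z; exact: nmin.
have := fan_det_neq0 sS sa sb; rewrite eq_sym => /(_ ba); rewrite neq_lt => /orP[d|d].
  by exists b; apply: (pos b a); rewrite // det2_antisym oppr_gt0.
by exists a; apply: (pos a b).
Qed.

Lemma ray_inj_int i j : dz i j = 0 -> 0 < dot2 (ray S i) (ray S j) -> i = j.
Proof. by move=> e p; apply: ray_inj; rewrite ?det2_toR ?dot2_toR ?e ?ltr0z. Qed.

End FanGeometry.

(** * Sign patterns *)

Section AntipodalRays.
Variables (I : finType) (v : I -> 'rV[int]_2) (nxt : I -> I).
Local Notation D i j := (det2 (v i) (v j)).
Hypothesis v_inj : forall i j, D i j = 0 -> 0 < dot2 (v i) (v j) -> i = j.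
Hypothesis det_nxt : forall i, 0 < D i (nxt i).
Hypothesis nxt_min : forall i k, 0 < D i k -> 0 <= D (nxt i) k.

(** The Cramer relation applied to a linear form: as the rays span the plane, it says that [q] is
    the restriction of a rational linear form, without naming the form. *)
Definition three_term (q : I -> int) := forall a b l,
  q a * D b l + q b * D l a + q l * D a b = 0.

Lemma same_side_l i j k : D i j = 0 -> 0 < D k i -> 0 < D k j -> i = j.
Proof.
move=> ij ki kj; apply: (v_inj ij).
have := det2_dot2 (v i) (v j) (v k); rewrite ij mul0r subr0.
have i0 : 0 < dot2 (v i) (v i) by rewrite dot2_gt0 (ray_neq0 det_nxt).
rewrite ![det2 _ (v k)]det2_antisym mulNr mulrN => /oppr_inj e.
by have := mulr_gt0 kj i0; rewrite e pmulr_lgt0.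
Qed.

Lemma antipodal i j : D i j = 0 -> i != j ->
  exists c1 c2 : int, [/\ 0 < c1, 0 < c2 & c1 *: v i + c2 *: v j = 0].
Proof.
move=> ij neq_ij; exists (dot2 (v j) (v j)), (- dot2 (v i) (v j)).
have j0 : 0 < dot2 (v j) (v j) by rewrite dot2_gt0 (ray_neq0 det_nxt).
have e := det2_eq0_scale ij; split=> //; last by rewrite e scaleNr subrr.
rewrite oppr_gt0 lt_neqAle leNgt; apply/andP; split; last first.
  by apply: contra neq_ij => /(v_inj ij) ->.
apply/eqP=> d0; have := dot2_lagrange (v i) (v j); rewrite ij d0 !expr0n addr0 => e0.
have i0 : 0 < dot2 (v i) (v i) by rewrite dot2_gt0 (ray_neq0 det_nxt).
by have := mulr_gt0 i0 j0; rewrite e0 ltxx.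
Qed.

Section OneExit.
Variables (i j : I) (c1 c2 : int) (N : {set I}) (q1 q2 : I -> int).
Hypotheses (c1_gt0 : 0 < c1) (c2_gt0 : 0 < c2) (vij : c1 *: v i + c2 *: v j = 0).
Hypotheses (iN : i \in N) (jN : j \notin N).
Hypotheses (q1P : three_term q1) (q2P : three_term q2).
Hypotheses (q1i : q1 i <= 0) (q2i : q2 i <= 0).
Hypothesis (Nleft : forall l, 0 < D i l -> (l \in N) = (q1 l < 0)).
Hypothesis (Nright : forall l, D i l < 0 -> (l \in N) = (q2 l < 0)).

Let det_ij l : c1 * D i l + c2 * D j l = 0.
Proof. exact: det2_antipodal vij. Qed.

Let on_line l : D i l = 0 -> l = i \/ l = j.
Proof.
move=> il; have jl : D l j = 0.
  have := det_ij l; rewrite il mulr0 add0r det2_antisym => /eqP.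
  by rewrite mulf_eq0 gt_eqF //= oppr_eq0 => /eqP.
have dl : c1 * dot2 (v l) (v i) + c2 * dot2 (v l) (v j) = 0.
  transitivity (dot2 (v l) (c1 *: v i + c2 *: v j)).
    by rewrite /dot2 !mxE; ring.
  by rewrite vij /dot2 !mxE !mulr0 addr0.
have li : D l i = 0 by rewrite det2_antisym il oppr0.
have [d0|d0|d0] := ltgtP (dot2 (v l) (v i)) 0.
- by right; apply: (v_inj jl); nia.
- by left; apply: (v_inj li).
have := dot2_lagrange (v l) (v i); rewrite li d0 !expr0n addr0 => e0.
have i0 : 0 < dot2 (v i) (v i) by rewrite dot2_gt0 (ray_neq0 det_nxt).
have l0 : 0 < dot2 (v l) (v l) by rewrite dot2_gt0 (ray_neq0 det_nxt).
by have := mulr_gt0 l0 i0; rewrite e0 ltxx.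
Qed.

(** To the right of [v i], the successor [k] of [l] lies between [l] and [i] or is [i]. In the first
    case [q2], negative at [l] and nonpositive at [i], is negative at [k]; so [k] stays in [N] in
    both cases. *)
Let exit_left l : l \in exits nxt N -> l = i \/ 0 < D i l.
Proof.
rewrite inE => /andP[lN kN]; have lk := det_nxt l; set k := nxt l in kN lk.
have [il|il|/on_line[->|lj]] := ltgtP (D i l) 0; [|by right|by left|]; last first.
  by rewrite lj (negPf jN) in lN.
have li : 0 < D l i by rewrite det2_antisym oppr_gt0.
have ki := nxt_min li; rewrite -/k in ki.
have [ki0|ki0|ki0] := ltgtP (D k i) 0; first by rewrite leNgt ki0 in ki.
  have ik : D i k < 0 by rewrite det2_antisym oppr_lt0.
  have := Nright ik; rewrite (negPf kN) => /esym/negbT; rewrite -leNgt => qk.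
  have := Nright il; rewrite lN => /esym ql.
  have t1 : q2 l * D k i < 0 by rewrite pmulr_llt0.
  have t2 : q2 i * D l k <= 0 by rewrite pmulr_lle0.
  have t3 : 0 <= q2 k * D l i by rewrite mulr_ge0 // ltW.
  have := q2P l i k; rewrite [D i k]det2_antisym [D k l]det2_antisym; lia.
have /on_line[ki'|kj] : D i k = 0 by rewrite det2_antisym ki0 oppr0.
  by rewrite ki' iN in kN.
have := det_ij l; rewrite -kj [D k l]det2_antisym; nia.
Qed.

(** The successor [k] of [l1] lies between [l1] and [l2]. There [q1] is nonpositive and negative
    respectively, so it is negative at [k], which contradicts that [k] has left [N]. *)
Let no_two_exits l1 l2 : l1 \in exits nxt N -> l2 \in exits nxt N -> ~~ (0 < D l1 l2).
Proof.
move=> e1 e2; apply/negP=> l12.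
have h1 := exit_left e1; have h2 := exit_left e2.
move: e1 e2; rewrite !inE => /andP[l1N kN] /andP[l2N _].
have l1k := det_nxt l1; have kl2 := nxt_min l12; set k := nxt l1 in kN l1k kl2.
have i2 : 0 < D i l2.
  case: h2 => // e2; move: l12; rewrite e2; case: h1 => [->|].
    by rewrite det2vv.
  by rewrite [D l1 i]det2_antisym; lia.
have kl2' : 0 < D k l2.
  rewrite lt_neqAle kl2 andbT eq_sym; apply/eqP=> k0; move: kN.
  by rewrite (same_side_l k0 l1k l12) l2N.
have ik : 0 < D i k.
  case: h1 => [<- //|i1].
  have : D i k * D l1 l2 = D i l1 * D k l2 + D i l2 * D l1 k by rewrite /det2; ring.
  by nia.
have := Nleft ik; rewrite (negPf kN) => /esym/negbT; rewrite -leNgt => qk.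
have := Nleft i2; rewrite l2N => /esym ql2.
have q1l : q1 l1 <= 0.
  case: h1 => [->|i1] //; have := Nleft i1; rewrite l1N => /esym; exact: ltW.
have t1 : q1 l2 * D l1 k < 0 by rewrite pmulr_llt0.
have t2 : q1 l1 * D k l2 <= 0 by rewrite pmulr_lle0.
have t3 : 0 <= q1 k * D l1 l2 by rewrite mulr_ge0 // ltW.
have := q1P l1 l2 k; rewrite [D l2 k]det2_antisym [D k l1]det2_antisym; lia.
Qed.

Lemma antipodal_one_exit : #|exits nxt N| = 1%N.
Proof.
have /set0Pn[l lE] : exits nxt N != set0.
  apply: (exits_nonempty (nxt_det_connected v_inj det_nxt nxt_min)).
    by apply/set0Pn; exists i.
  by apply/eqP=> NT; move: jN; rewrite NT inE.
apply/eqP/cards1P; exists l; apply/setP=> l'; rewrite inE; apply/idP/eqP=> [l'E|->] //.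
have /le_anti/esym/eqP : (D l l' <= 0) && (0 <= D l l').
  by rewrite leNgt no_two_exits //= det2_antisym oppr_ge0 leNgt no_two_exits.
move=> /eqP/esym ll'.
have [li|il] := exit_left lE; have [l'i|il'] := exit_left l'E.
- by rewrite li l'i.
- by move: il'; rewrite -li ll' ltxx.
- by move: il; rewrite -l'i det2_antisym ll' oppr0 ltxx.
by rewrite (same_side_l ll' il il').
Qed.

End OneExit.
End AntipodalRays.

(** The open interval from [-Q/b] to [P/a] has length at least [L + 1], so it contains [L]
    consecutive integers, starting at the first one above [-Q/b]. *)
Lemma long_interval (a b P Q L : int) : 0 < a -> 0 < b -> a * b * (L + 1) <= P * b + Q * a ->
  exists t0 : int, forall s : int, 0 <= s -> s < L -> (t0 + s) * a < P /\ - Q < (t0 + s) * b.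
Proof.
move=> a0 b0 PQ; exists ((- Q %/ b)%Z + 1) => s s0 sL.
have e := divz_eq (- Q) b; set t := (- Q %/ b)%Z in e *.
have m0 := modz_ge0 (- Q) (lt0r_neq0 b0); have mb := ltz_pmod (- Q) b0.
set m := (- Q %% b)%Z in e m0 mb; split; last first.
  have : 0 <= s * b by rewrite mulr_ge0 // ltW.
  by rewrite e !mulrDl mul1r; lia.
rewrite -(ltr_pM2r b0).
have : (t + 1 + s) * b * a <= (- Q + (s + 1) * b) * a.
  rewrite ler_pM2r // e !mulrDl mul1r; lia.
have : (- Q + (s + 1) * b) * a <= P * b - a * b.
  have : a * b * (s + 1) <= a * b * L by rewrite ler_pM2l ?mulr_gt0 //; lia.
  have -> : (- Q + (s + 1) * b) * a = a * b * (s + 1) - Q * a by ring.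
  move: PQ; rewrite [a * b * (L + 1)]mulrDr mulr1; move: (a * b * L) (a * b * (s + 1)).
  by move: (a * b) (P * b) (Q * a) => *; lia.
have : 0 < a * b by rewrite mulr_gt0.
rewrite mulrAC; move: (a * b) (P * b * a) ((t + 1 + s) * b * a) => *; lia.
Qed.

Lemma card_near_zero (c e : int) (M L : nat) : e != 0 ->
  leq #|[set s : 'I_L | `|c + (val s)%:Z * e| <= M%:Z]| (2 * M).+1.
Proof.
move=> e0; set A := [set s | _].
pose f (s : 'I_L) : 'I_(2 * M).+1 := inord (absz (c + (val s)%:Z * e + M%:Z)).
have f_inj : {in A &, injective f}.
  move=> s s'; rewrite !inE => sA s'A /(congr1 (@nat_of_ord _)).
  rewrite /f !inordK; [|lia|lia] => fss'.
  have {}fss' : (val s)%:Z * e = (val s')%:Z * e.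
    by move: sA s'A fss'; move: ((val s)%:Z * e) ((val s')%:Z * e) => x y; lia.
  by apply: val_inj; have /= := mulIf e0 fss' => -[].
by rewrite -(card_in_imset f_inj) -[leqRHS]card_ord max_card.
Qed.

(** * No collinear rays: bounds on normalized representatives *)

Section FarFromDiagonal.
Variables (I : finType) (v : I -> 'rV[int]_2) (nxt : I -> I).
Local Notation D i j := (det2 (v i) (v j)).
Hypothesis v_inj : forall i j, D i j = 0 -> 0 < dot2 (v i) (v j) -> i = j.
Hypothesis det_nxt : forall i, 0 < D i (nxt i).
Hypothesis nxt_min : forall i k, 0 < D i k -> 0 <= D (nxt i) k.
Hypothesis D_neq0 : forall i j, i != j -> D i j != 0.

Definition negatives (q : I -> int) := [set l | q l < 0].

(** The consequence of H-triviality used for the bounds: the one-exit criterion at all exponents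
    that differ from [r] by an integral linear form. *)
Definition always_one_exit (r : I -> int) := forall w : 'rV[int]_2,
  #|exits nxt (negatives (fun l => r l + dot2 w (v l)))| = 1%N.

(* Vanishes exactly when r is linear on the three consecutive rays. *)
Definition bend (r : I -> int) p :=
  r p * D (nxt p) (nxt (nxt p)) + r (nxt p) * D (nxt (nxt p)) p
  + r (nxt (nxt p)) * D p (nxt p).

Let nxt_inj := nxt_det_inj v_inj det_nxt nxt_min.
Let nxt2_neq := nxt2_det_neq det_nxt.

(** If both neighbours of [nxt p] are in [N], adding it closes a gap and removes the exit [p]; if
    neither is, it becomes a new exit itself. *)
Lemma exits_flip (N : {set I}) p : nxt p \notin N -> (p \in N) = (nxt (nxt p) \in N) ->
  #|exits nxt N| <> #|exits nxt (nxt p |: N)|.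
Proof.
set i := nxt p => iN pq; have [qi pi] : nxt i != i /\ p != i.
  by split; rewrite ?[p == _]eq_sym (nxt_neq nxt2_neq).
have nxtE l : (nxt l == i) = (l == p) by rewrite (inj_eq nxt_inj).
have [qN|qN] := boolP (nxt i \in N).
  have -> : exits nxt N = p |: exits nxt (i |: N).
    apply/setP=> l; rewrite !inE nxtE; have [->|lp] := eqVneq l p.
      by rewrite /= pq qN iN.
    by have [->|] //= := eqVneq l i; rewrite (negPf iN) qN.
  by rewrite cardsU1 !inE eqxx /= andbF => e; lia.
have -> : exits nxt (i |: N) = i |: exits nxt N.
  apply/setP=> l; rewrite !inE nxtE; have [->|li] /= := eqVneq l i.
    by rewrite eq_sym (negPf pi) qN.
  by have [->|//] := eqVneq l p; rewrite pq (negPf qN).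
by rewrite cardsU1 !inE (negPf iN) /= => e; lia.
Qed.

(** Each [l] excludes at most [2M + 1] values of [s], and there is one more candidate than can be
    excluded in total. *)
Lemma avoid_near_zero (c e : I -> int) (M : nat) (A : {set I}) :
  (forall l, l \in A -> e l != 0) ->
  exists s : 'I_(#|I| * (2 * M).+1).+1,
    forall l, l \in A -> M%:Z < `|c l + (val s)%:Z * e l|.
Proof.
move=> e0; set L := (_.+1).
pose bad l := [set s : 'I_L | `|c l + (val s)%:Z * e l| <= M%:Z].
have card_bad : (#|\bigcup_(l in A) bad l| < L)%N.
  have card_le : (#|\bigcup_(l in A) bad l| <= \sum_(l in A) (2 * M).+1)%N.
    elim/big_ind2: _ => [|m X k Y Xm Yk|l /e0]; first by rewrite cards0.
      by have [XY _] := leq_card_setU X Y; apply: leq_trans XY _; rewrite leq_add.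
    exact: card_near_zero.
  rewrite ltnS; apply: leq_trans card_le _.
  by rewrite sum_nat_const leq_mul2r max_card orbT.
have /set0Pn[s] : ~: (\bigcup_(l in A) bad l) != set0.
  by rewrite -card_gt0 cardsCs setCK card_ord subn_gt0.
rewrite inE => sbad; exists s => l lA; rewrite ltNge; apply: contra sbad => sl.
by apply/bigcupP; exists l; rewrite ?inE.
Qed.

Lemma bend_bounded p : exists K : int,
  forall r, always_one_exit r -> `|bend r p| <= K.
Proof.
set i := nxt p; set q := nxt i.
have alpha0 : 0 < D p i by exact: det_nxt.
have beta0 : 0 < D i q by exact: det_nxt.
have i0 : 0 < dot2 (v i) (v i) by rewrite dot2_gt0 (ray_neq0 det_nxt).
(* [M] bounds the change of every coordinate when [v i] is subtracted from [w], and [L] is the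
   number of positions required by [avoid_near_zero]. *)
pose M := (\sum_l absz (dot2 (v i) (v l)))%N.
have leM l : `|dot2 (v i) (v l)| <= M%:Z.
  by rewrite -abszE lez_nat /M (bigD1 l) //= leq_addr.
pose L := (#|I| * (2 * M).+1).+1.
exists (D p i * D i q * (L%:Z + 1) + dot2 (v i) (v i) * `|D q p|) => r good.
(* The multiple [a] of [v i] brings coordinate [i] into the range from 0 to [dot2 (v i) (v i)], so
   that subtracting [v i] once more makes it negative. The parameter [t] moves [w] orthogonally to
   [v i] and leaves this coordinate fixed. *)
pose a := - (r i %/ dot2 (v i) (v i))%Z.
pose w t : 'rV[int]_2 := \row_j (a * v i 0 j + t * (if j == 0 then - v i 0 1 else v i 0 0)).
pose psi t l := r l + dot2 (w t) (v l).
have psiE t l : psi t l = psi 0 l + t * D i l.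
  by rewrite /psi /dot2 /det2 !mxE /=; ring.
have psi_i t : psi t i = (r i %% dot2 (v i) (v i))%Z.
  have wi : dot2 (w 0) (v i) = a * dot2 (v i) (v i) by rewrite /dot2 !mxE; ring.
  by rewrite psiE det2vv mulr0 addr0 /psi wi /a mulNr.
have psi_i0 t : 0 <= psi t i by rewrite psi_i modz_ge0 ?lt0r_neq0.
have psi_i1 t : psi t i < dot2 (v i) (v i) by rewrite psi_i ltz_pmod.
have bendE : bend r p = psi 0 p * D i q + psi 0 i * D q p + psi 0 q * D p i.
  by rewrite /bend /psi -/i -/q /dot2 /det2 !mxE /=; ring.
(* If p and q lie on the same side of zero and no psi t l is small, then w t and
   w t - v i give sign patterns differing at i only. *)
have crossing t : (psi t p < 0) = (psi t q < 0) ->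
    (forall l, l != i -> M%:Z < `|psi t l|) -> False.
  move=> pq big; have := good (w t); have := good (w t - v i).
  set N' := negatives _; set N := negatives _ => e' e.
  have psi' l : r l + dot2 (w t - v i) (v l) = psi t l - dot2 (v i) (v l).
    by rewrite /psi /dot2 !mxE /=; ring.
  have NE l : (l \in N) = (psi t l < 0) by rewrite inE.
  apply: (@exits_flip N p); rewrite ?NE //; first by rewrite -leNgt.
  rewrite e -e'; congr #|pred_of_set (exits nxt _)|; apply/setP=> l.
  rewrite !inE psi' -/(psi t l); have [->|li] /= := eqVneq l i.
    by rewrite subr_lt0 psi_i1.
  by have := big l li; have := leM l; move: (psi t l) (dot2 _ _) => x y; lia.
have same_sign t0 : (forall s : int, 0 <= s -> s < L ->
    (psi (t0 + s) p < 0) = (psi (t0 + s) q < 0)) -> False.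
  move=> st; have [l|s sP] := @avoid_near_zero (psi t0) (fun l => D i l) M [set~ i].
    by rewrite !inE eq_sym => /D_neq0.
  apply: (crossing (t0 + (val s)%:Z)).
    by apply: st => //; rewrite ltz_nat ltn_ord.
  move=> l li; rewrite psiE mulrDl addrA -psiE; apply: sP.
  by rewrite !inE.
have Dip : D i p = - D p i by rewrite det2_antisym.
rewrite leNgt; apply/negP=> big.
have i_small : `|psi 0 i * D q p| <= dot2 (v i) (v i) * `|D q p|.
  by rewrite normrM ger0_norm ?psi_i0 // ler_wpM2r // ltW.
have big' : D p i * D i q * (L%:Z + 1) < `|psi 0 p * D i q + psi 0 q * D p i|.
  move: big i_small; rewrite bendE; move: (_ * `|_|) (psi 0 i * _) (psi 0 p * _) (psi 0 q * _).
  by move: (D p i * D i q * _) => *; lia.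
(* Along [t] the coordinates [p] and [q] move in opposite directions. According to the sign of the
   bend, they are both positive or both negative on [L] consecutive positions. *)
have [pos|neg] := leP 0 (psi 0 p * D i q + psi 0 q * D p i).
  rewrite ger0_norm // in big'.
  have [t0 t0P] := long_interval alpha0 beta0 (ltW big').
  apply: (same_sign t0) => s s0 sL; have [tp tq] := t0P s s0 sL.
  rewrite !(psiE (t0 + s)) Dip mulrN.
  by move: ((t0 + s) * _) ((t0 + s) * _) tp tq => x y tp tq; lia.
rewrite ltr0_norm // in big'.
have [t0 t0P] : exists t0 : int, forall s : int, 0 <= s -> s < L%:Z ->
    (t0 + s) * D i q < - psi 0 q /\ - (- psi 0 p) < (t0 + s) * D p i.
  apply: long_interval => //; apply: ltW; rewrite [D i q * _]mulrC.
  by apply: lt_le_trans big' _; rewrite opprD !mulNr addrC.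
apply: (same_sign t0) => s s0 sL; have [tq tp] := t0P s s0 sL.
rewrite !(psiE (t0 + s)) Dip mulrN.
by move: ((t0 + s) * _) ((t0 + s) * _) tp tq => x y tp tq; lia.
Qed.

(** A choice of representative modulo linear forms: the values on two adjacent rays are reduced
    modulo their determinant. *)
Definition normalized (a : I) (r : I -> int) :=
  [/\ always_one_exit r, 0 <= r a < D a (nxt a) & 0 <= r (nxt a) < D a (nxt a)].

Lemma normalized_shift (a : I) r : always_one_exit r ->
  exists w : 'rV[int]_2, normalized a (fun l => r l + dot2 w (v l)).
Proof.
move=> good; set b := nxt a; have Dab : 0 < D a b by exact: det_nxt.
pose x := - (r b %/ D a b)%Z; pose y := - (r a %/ D a b)%Z.
(* The form [x * det2 (v a) _ + y * det2 _ (v b)], with values [y * D a b] at [a] and [x * D a b] at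
   [b]. *)
pose w : 'rV[int]_2 := \row_j (if j == 0 then y * v b 0 1 - x * v a 0 1
                                        else x * v a 0 0 - y * v b 0 0).
have wE l : dot2 w (v l) = x * D a l + y * D l b.
  by rewrite /dot2 /det2 !mxE /=; ring.
have modE (k d : int) : k + - (k %/ d)%Z * d = (k %% d)%Z by rewrite mulNr.
exists w; split.
- move=> w'; rewrite -(good (w + w')); congr #|pred_of_set (exits nxt (negatives _))|.
  by apply/funext=> l; rewrite /dot2 !mxE; ring.
- by rewrite wE det2vv mulr0 add0r modE modz_ge0 ?lt0r_neq0 //= ltz_pmod.
by rewrite -/b wE det2vv mulr0 addr0 modE modz_ge0 ?lt0r_neq0 //= ltz_pmod.
Qed.

(** Propagation along the cycle: the bound on the bend at [p] turns bounds at [p] and [nxt p] into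
    one at the following ray, since [D p (nxt p)] is at least 1. *)
Lemma normalized_bounded (a l : I) : exists K : int,
  forall r, normalized a r -> `|r l| <= K.
Proof.
pose bounded l := exists K : int, forall r, normalized a r -> `|r l| <= K.
suff : l \in [set l | `[< bounded l /\ bounded (nxt l) >]].
  by rewrite inE => /asboolP[].
set N := [set _ | _]; suff -> : N = [set: I] by rewrite inE.
apply: (nxt_det_connected v_inj det_nxt nxt_min); last first.
  apply/set0Pn; exists a; rewrite inE; apply/asboolP; split; exists (D a (nxt a)).
    by move=> r [_ + _]; lia.
  by move=> r [_ _ +]; lia.
move=> p; rewrite !inE => /asboolP[[K1 K1P] bi]; apply/asboolP; split=> //.
case: (bi) => K2 K2P; have [K3 K3P] := bend_bounded p.
set i := nxt p; set q := nxt i.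
exists (K3 + K1 * `|D i q| + K2 * `|D q p|) => r nr.
have pi : 1 <= D p i by have := det_nxt p; rewrite -/i; lia.
have good : always_one_exit r by case: nr.
have bP := K3P r good; have pP := K1P r nr; have iP := K2P r nr.
apply: (@le_trans _ _ `|r q * D p i|).
  by rewrite normrM ler_peMr // ger0_norm //; lia.
have -> : r q * D p i = bend r p - r p * D i q - r i * D q p by rewrite /bend -/i -/q; ring.
have t1 : `|r p * D i q| <= K1 * `|D i q| by rewrite normrM ler_wpM2r.
have t2 : `|r i * D q p| <= K2 * `|D q p| by rewrite normrM ler_wpM2r.
by move: (bend r p) (r p * _) (r i * _) (K1 * _) (K2 * _) bP t1 t2 => *; lia.
Qed.

End FarFromDiagonal.

(** * Laurent expansion of sections *)

From mathcomp Require Import classical_sets cardinality complex mpoly.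
(* [classical_sets] has its own [point]. *)
Import Defs.

Section LaurentExpansion.
Variables (R : realType) (n : nat) (S : stacky_fan n).
Local Notation F := (complex R).
Local Notation cones := (maximal_cone S).
Implicit Types (m r : 'rV[int]_n) (x z : point R n) (s : {set 'I_n}) (M : seq 'rV[int]_n).

Definition mono m x : F := \prod_i x i ^ m ord0 i.

Definition torus x := forall i, x i != 0.

Lemma mono_act m z x : mono m (act z x) = mono m z * mono m x.
Proof. by rewrite /mono -big_split; apply: eq_bigr => i _; rewrite /= expfzMl. Qed.

Lemma mono_neq0 m x : torus x -> mono m x != 0.
Proof. by move=> x0; apply/prodf_neq0 => i _; rewrite expfz_neq0. Qed.

Lemma mono_separates m m' : m != m' -> exists2 z, torus z & mono m z != mono m' z.
Proof.
move=> mm'; have [i mi] : exists i, m ord0 i != m' ord0 i.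
  apply/existsP; apply: contraR mm'; rewrite negb_exists => /forallP e.
  by apply/eqP/rowP=> i; have := e i; rewrite negbK => /eqP.
have two : (2%:R : F) != 0 by rewrite pnatr_eq0.
exists (fun j => if j == i then 2%:R else 1).
  by move=> j; case: ifP => _; rewrite ?oner_eq0.
have mE m0 : mono m0 (fun j => if j == i then 2%:R else 1) = 2%:R ^ m0 ord0 i.
  rewrite /mono (bigD1 i) //= eqxx big1 ?mulr1 // => j /negPf ->.
  by rewrite exp1rz.
rewrite !mE; apply: contra mi => /eqP e.
have : (2%:R : F) ^ (m ord0 i - m' ord0 i) == 1.
  by rewrite expfzDr // e -expfzDr // subrr expr0z.
by rewrite pexprz_eq1 ?ler0n // pnatr_eq1 orbF subr_eq0.
Qed.

(** Linear independence of characters: translating by a torus point [z] that separates [m0] from [m]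
    and subtracting eliminates the term [m0]. *)
Lemma mono_indep M (c : 'rV[int]_n -> F) : uniq M ->
  (forall x, torus x -> \sum_(m <- M) c m * mono m x = 0) ->
  {in M, forall m, c m = 0}.
Proof.
elim: M c => // m0 M IHM c /= /andP[m0M uM] H.
have cM : {in M, forall m, c m = 0}.
  move=> m mM; have m0m : m0 != m by apply: contraNneq m0M => ->.
  have [z z0 sep] := mono_separates m0m.
  have /eqP : c m * (mono m z - mono m0 z) = 0.
    apply: (IHM (fun m' => c m' * (mono m' z - mono m0 z))) => // x x0.
    have zx0 : torus (act z x) by move=> i; rewrite mulf_neq0.
    transitivity (\sum_(m' <- m0 :: M) c m' * mono m' (act z x) -
        mono m0 z * \sum_(m' <- m0 :: M) c m' * mono m' x).
      rewrite mulr_sumr -sumrB big_cons mono_act mulrCA subrr add0r.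
      by apply: eq_bigr => m' _; rewrite mono_act; ring.
    by rewrite !H // mulr0 subrr.
  by rewrite mulf_eq0 subr_eq0 [mono m z == _]eq_sym (negPf sep) orbF => /eqP.
move=> m; rewrite inE => /orP[/eqP ->|/cM //].
have one0 : torus (fun=> 1) by move=> i; rewrite oner_eq0.
have := H _ one0; rewrite big_cons big_seq big1 => [|m' /cM ->]; last by rewrite mul0r.
by move/eqP; rewrite addr0 mulf_eq0 (negPf (mono_neq0 _ one0)) orbF => /eqP.
Qed.

Lemma regular_onD s (f g : point R n -> F) :
  regular_on s f -> regular_on s g -> regular_on s (fun x => f x + g x).
Proof.
move=> [p [k fp]] [q [l gq]]; pose h : {mpoly F[n]} := \prod_(i | i \notin s) 'X_i.
have hE x : h.@[x] = \prod_(i | i \notin s) x i.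
  by rewrite rmorph_prod; apply: eq_bigr => i _; exact: mevalXU.
exists (p * h ^+ l + q * h ^+ k), (k + l)%N => x sx.
rewrite mevalD !mevalM !rmorphXn /= hE -fp // -gq // exprD; ring.
Qed.

Lemma regular_on0 s : regular_on s (fun _ : point R n => 0).
Proof. by exists 0, 0%N => x _; rewrite mul0r meval0. Qed.

Lemma regular_on_mono s m (a : F) : (forall i, i \in s -> 0 <= m ord0 i) ->
  regular_on s (fun x => a * mono m x).
Proof.
(* This power of the denominator clears every negative exponent outside [s] at once. *)
move=> ms; pose k := (\sum_i `|m ord0 i|)%N.
pose e : 'X_{1..n} := [multinom absz (m ord0 i + (if i \in s then 0 else k%:Z))%R | i < n].
exists (a *: 'X_[e]), k => x sx; rewrite mevalZ mevalX -mulrA; congr (_ * _).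
rewrite big_mkcond /= -prodrXl -big_split; apply: eq_bigr => i _ /=.
rewrite mnmE; have [si|si] /= := boolP (i \in s).
  by rewrite addr0 expr1n mulr1 -{1}(gez0_abs (ms i si)).
have mk : 0 <= m ord0 i + k%:Z.
  have : (`|m ord0 i| <= k)%N by rewrite /k (bigD1 i) //= leq_addr.
  by lia.
by rewrite !exprnP gez0_abs // expfzDr ?sx.
Qed.

Lemma regular_on_sum s M (c : 'rV[int]_n -> F) :
  (forall m, c m != 0 -> forall i, i \in s -> 0 <= m ord0 i) ->
  regular_on s (fun x => \sum_(m <- M) c m * mono m x).
Proof.
move=> cs; elim: M => [|m M IHM].
  rewrite (_ : (fun=> _) = fun=> 0); first exact: regular_on0.
  by apply/funext=> x; rewrite big_nil.
rewrite (_ : (fun=> _) = fun x => c m * mono m x + \sum_(m' <- M) c m' * mono m' x).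
  apply: regular_onD => //; have [->|/cs] := eqVneq (c m) 0; last exact: regular_on_mono.
  rewrite (_ : (fun=> _) = fun=> 0); first exact: regular_on0.
  by apply/funext=> x; rewrite mul0r.
by apply/funext=> x; rewrite big_cons.
Qed.

Lemma regular_on_expansion s (f : point R n -> F) : regular_on s f ->
  exists (M : seq 'rV[int]_n) (c : 'rV[int]_n -> F), [/\ uniq M,
    forall x, chart s x -> f x = \sum_(m <- M) c m * mono m x
    & forall m, m \in M -> forall i, i \in s -> 0 <= m ord0 i].
Proof.
case=> p [k fp]; pose off (i : 'I_n) : int := if i \in s then 0 else k%:Z.
pose expo (e : 'X_{1..n}) : 'rV[int]_n := \row_i ((e i)%:Z - off i).
pose unexpo (m : 'rV[int]_n) : 'X_{1..n} := [multinom absz (m ord0 i + off i)%R | i < n].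
have expoK : cancel expo unexpo.
  by move=> e; apply/mnmP=> i; rewrite mnmE mxE subrK.
exists [seq expo e | e <- msupp p], (fun m => p@_(unexpo m)); split.
- by rewrite (map_inj_uniq (can_inj expoK)) msupp_uniq.
- move=> x sx; have h0 : (\prod_(i | i \notin s) x i) ^+ k != 0.
    by rewrite expf_neq0 //; apply/prodf_neq0 => i; exact: sx.
  apply: (mulIf h0); rewrite fp // mevalE mulr_suml [RHS]big_map.
  apply: eq_bigr => e _; rewrite expoK -mulrA; congr (_ * _).
  rewrite [X in _ * X ^+ _]big_mkcond /= -prodrXl -big_split; apply: eq_bigr => i _ /=.
  rewrite mxE /off; have [si|si] /= := boolP (i \in s).
    by rewrite subr0 expr1n mulr1.
  by rewrite !exprnP -expfzDr ?subrK ?sx.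
move=> m /mapP[e _ ->] i si; rewrite mxE /off si subr0 //.
Qed.

(** The monomials [m] and [r] restrict to the same character of the group, which is the equivariance
    required of a monomial section. *)
Definition homogeneous r m := forall z, stackG S z -> mono m z = mono r z.

(** For fixed [z], comparing coefficients in the equivariance of [f] by [mono_indep] kills each
    coefficient whose character at [z] differs from that of [r]. *)
Lemma section_expansion r s f : section S r s f ->
  exists (M : seq 'rV[int]_n) (c : 'rV[int]_n -> F), [/\ uniq M,
    forall x, chart s x -> f x = \sum_(m <- M) c m * mono m x,
    forall m, m \in M -> forall i, i \in s -> 0 <= m ord0 i
    & forall m, m \in M -> c m != 0 -> homogeneous r m].
Proof.
case=> /regular_on_expansion[M [c [uM fM Ms]]] eq_f; exists M, c; split=> // m mM cm0 z zG.
have zT : torus z by case: zG.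
have /eqP : c m * (mono m z - mono r z) = 0.
  apply: (mono_indep (c := fun m' => c m' * (mono m' z - mono r z)) uM) mM => x xT.
  have sx : chart s x by move=> i _; exact: xT.
  have szx : chart s (act z x) by move=> i _; rewrite mulf_neq0.
  have := eq_f z x zG sx; rewrite !fM // -/(mono r z) => e.
  transitivity (\sum_(m' <- M) c m' * mono m' (act z x) -
      (\sum_(m' <- M) c m' * mono m' x) * mono r z).
    rewrite mulr_suml -sumrB; apply: eq_bigr => m' _; rewrite mono_act; ring.
  by rewrite e subrr.
by rewrite mulf_eq0 (negPf cm0) subr_eq0 => /eqP.
Qed.

Lemma section_sum r s M (c : 'rV[int]_n -> F) :
  (forall m, c m != 0 -> forall i, i \in s -> 0 <= m ord0 i) ->
  (forall m, c m != 0 -> homogeneous r m) ->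
  section S r s (fun x => \sum_(m <- M) c m * mono m x).
Proof.
move=> cs ch; split; first exact: regular_on_sum.
move=> z x zG _; rewrite mulr_suml; apply: eq_bigr => m _.
have [->|/ch/(_ z zG) e] := eqVneq (c m) 0; first by rewrite !mul0r.
by rewrite mono_act e -/(mono r z); ring.
Qed.

(** There are finitely many tuples, so their exponent lists merge into one; [m0] is added so that
    the part of a prescribed degree can be extracted. *)
Lemma cochain_expansion r j (f : cochain_type R S j) m0 : cochain r f ->
  exists (M : seq 'rV[int]_n) (c : 'rV[int]_n -> tuples cones j -> F),
  [/\ uniq M, m0 \in M,
    forall t x, chart (overlap t) x -> f t x = \sum_(m <- M) c m t * mono m x,
    forall m t, c m t != 0 -> forall i, i \in overlap t -> 0 <= m ord0 i
    & forall m t, c m t != 0 -> homogeneous r m].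
Proof.
move=> hf; pose P t (Mc : seq 'rV[int]_n * ('rV[int]_n -> F)) := [/\ uniq Mc.1,
    forall x, chart (overlap t) x -> f t x = \sum_(m <- Mc.1) Mc.2 m * mono m x,
    forall m, m \in Mc.1 -> forall i, i \in overlap t -> 0 <= m ord0 i
    & forall m, m \in Mc.1 -> Mc.2 m != 0 -> homogeneous r m].
have /choice[Mc McP] : forall t, exists Mc, P t Mc.
  by move=> t; have [M [c H]] := section_expansion (hf t); exists (M, c).
pose M := undup (m0 :: flatten [seq (Mc t).1 | t : tuples cones j]).
exists M, (fun m t => if m \in (Mc t).1 then (Mc t).2 m else 0); split.
- exact: undup_uniq.
- by rewrite mem_undup mem_head.
- move=> t x tx; have [ut -> // _ _] := McP t.
  have -> : \sum_(m <- (Mc t).1) (Mc t).2 m * mono m x =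
      \sum_(m <- [seq m <- M | m \in (Mc t).1]) (Mc t).2 m * mono m x.
    apply: perm_big; apply: uniq_perm => //; first by rewrite filter_uniq ?undup_uniq.
    move=> m; rewrite mem_filter mem_undup inE.
    have [mt|//] /= := boolP (m \in (Mc t).1); apply/esym/orP; right.
    by apply/flatten_mapP; exists t; rewrite ?mem_enum.
  rewrite big_filter big_mkcond; apply: eq_bigr => m _.
  by case: ifP => // _; rewrite mul0r.
- by move=> m t; case: ifP => [mt _|]; [case: (McP t) => _ _ /(_ m mt)|rewrite eqxx].
by move=> m t; case: ifP => [mt|]; [case: (McP t) => _ _ _ /(_ m mt)|rewrite eqxx].
Qed.

Lemma overlapP j (t : tuples cones j) i :
  reflect (forall k, i \in val (t k)) (i \in overlap t).
Proof. by apply: (iffP bigcapP) => [H k|H k _]; exact: H. Qed.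

Lemma torus_chart s x : torus x -> chart s x.
Proof. by move=> xT i _; exact: xT. Qed.

Lemma cech_diff_expansion j (f : cochain_type R S j) M
    (c : 'rV[int]_n -> tuples cones j -> F) t x :
  (forall k, f (face t k) x = \sum_(m <- M) c m (face t k) * mono m x) ->
  cech_diff f t x = \sum_(m <- M) diff (c m) t * mono m x.
Proof.
move=> fE; rewrite /cech_diff.
transitivity (\sum_(k < j.+2) \sum_(m <- M) (-1) ^+ k * c m (face t k) * mono m x).
  by apply: eq_bigr => k _; rewrite [f _ x]fE mulr_sumr; apply: eq_bigr => m _; rewrite mulrA.
by rewrite exchange_big; apply: eq_bigr => m _; rewrite mulr_suml.
Qed.

Definition negative m := [set i : 'I_n | m ord0 i < 0]%SET.

Lemma avoids_negative m j (c : tuples cones j -> F) :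
  (forall t, c t != 0 -> forall i, i \in overlap t -> 0 <= m ord0 i) <->
  avoids (fun s : cones => val s) (negative m) c.
Proof.
split=> [H t [i im it]|H t ct i it].
  apply/eqP; apply: contraTT im => /H/(_ i (introT (overlapP _ _) it)).
  by rewrite inE leNgt.
rewrite leNgt; apply: contra ct => im; apply/eqP/H; exists i; first by rewrite inE.
exact/overlapP.
Qed.

(** The Cech complex splits by exponent. A combinatorial cocycle times [mono m] is a Cech cocycle,
    and the degree-[m] coefficient of a primitive is a primitive; conversely, primitives found
    degree by degree are summed over the finite support. *)
Lemma H_trivial_acyclic r : H_trivial R S r <->
  forall m, homogeneous r m -> acyclic F (fun s : cones => val s) (negative m).
Proof.
split=> [Htr m hm j c cN dc|ac j f [hf df]].
  have /avoids_negative cm := cN.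
  pose f : cochain_type R S j := fun t x => c t * mono m x.
  have fE t x : f t x = \sum_(m' <- [:: m]) c t * mono m' x by rewrite big_seq1.
  have hf : cochain r f.
    move=> t; pose c' m' := if m' == m then c t else 0.
    rewrite (_ : f t = fun x => \sum_(m' <- [:: m]) c' m' * mono m' x).
      apply: section_sum => m'; rewrite /c'; have [->|] := eqVneq m' m; rewrite ?eqxx //.
      exact: cm.
    by apply/funext=> x; rewrite big_seq1 /c' eqxx.
  have dfE t x : cech_diff f t x = diff c t * mono m x.
    by rewrite (cech_diff_expansion (M := [:: m]) (c := fun=> c)) ?big_seq1.
  have coc : cocycle r f by split=> // t x _; rewrite dfE dc mul0r.
  have one0 : torus (fun=> 1) by move=> i; rewrite oner_eq0.
  have := Htr j f coc.
  case: j c cN dc cm f fE hf dfE coc => [|j] c cN dc cm f fE hf dfE coc /=.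
    move=> f0 t; have /eqP := f0 t _ (fun i _ => one0 i).
    by rewrite fE big_seq1 mulf_eq0 (negPf (mono_neq0 _ one0)) orbF => /eqP.
  case=> g hg fg; have [M [b [uM mM gE bs _]]] := cochain_expansion m hg.
  exists (b m); first by apply/avoids_negative => t; exact: bs.
  move=> t; pose e m' := (if m' == m then c t else 0) - diff (b m') t.
  suff /eqP : e m = 0 by rewrite /e eqxx subr_eq0 => /eqP.
  apply: (mono_indep uM _ mM) => x xT.
  have := fg t x (fun i _ => xT i).
  rewrite fE big_seq1 (cech_diff_expansion (M := M) (c := b)); last first.
    by move=> k; apply: gE; exact: torus_chart.
  move=> ft; under eq_bigr do rewrite /e mulrBl.
  rewrite sumrB -ft (bigD1_seq m) //= eqxx big1 ?addr0 ?subrr // => m' /negPf ->.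
  by rewrite mul0r.
have [M [c [uM _ fE cs ch]]] := cochain_expansion 0 hf.
have cN m : avoids (fun s : cones => val s) (negative m) (c m).
  by apply/avoids_negative => t; exact: cs.
have c0 m t : ~ homogeneous r m -> c m t = 0.
  by move=> nh; apply/eqP; apply: contra_notT nh; exact: ch.
have dc m : m \in M -> closed_cochain (c m).
  move=> mM t; apply: (mono_indep (c := fun m' => diff (c m') t) uM) mM => x xT.
  rewrite -(cech_diff_expansion (f := f)); first exact/df/torus_chart.
  by move=> k; apply: fE; exact: torus_chart.
have ex m : m \in M -> homogeneous r m -> exact_cochain (fun s : cones => val s) (negative m) (c m).
  by move=> mM hm; apply: ac => //; exact: dc.
case: j f hf df c fE cs ch cN c0 dc ex => [|j] f hf df c fE cs ch cN c0 dc ex /=.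
  move=> t x tx; rewrite fE // big_seq big1 // => m mM.
  have [hm|/c0 ->] := pselect (homogeneous r m); last by rewrite mul0r.
  by rewrite [c m t](ex m mM hm) mul0r.
(* The primitive is taken to be zero outside the homogeneous degrees, so that the sum is again a
   cochain of the bundle. *)
have /choice[b bP] : forall m, exists b : tuples cones j -> F,
    [/\ avoids (fun s : cones => val s) (negative m) b,
      forall t, b t != 0 -> homogeneous r m & m \in M -> forall t, c m t = diff b t].
  move=> m; have [hm|nh] := pselect (homogeneous r m); last first.
    exists (fun=> 0); split=> // [t|_ t]; first by rewrite eqxx.
    by rewrite c0 // /diff big1 // => k _; rewrite mulr0.
  have [mM|] := boolP (m \in M); last by exists (fun=> 0); split.
  by have [b bN cb] := ex m mM hm; exists b.
exists (fun t x => \sum_(m <- M) b m t * mono m x).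
  move=> t; apply: (section_sum M (c := fun m => b m t)) => m; last by case: (bP m) => _ /(_ t).
  by case: (bP m) => /avoids_negative/(_ t).
move=> t x tx; rewrite fE // (cech_diff_expansion (M := M) (c := b)) //.
by rewrite !big_seq; apply: eq_bigr => m mM; case: (bP m) => _ _ /(_ mM) ->.
Qed.

End LaurentExpansion.

(** * H-trivial line bundles *)

Lemma dot2_is_zmod_morphism (w : 'rV[int]_2) : zmod_morphism (dot2 w).
Proof. by move=> x y; rewrite /dot2 !mxE; ring. Qed.

HB.instance Definition _ (w : 'rV[int]_2) :=
  GRing.isZmodMorphism.Build 'rV[int]_2 int (dot2 w) (dot2_is_zmod_morphism w).

Section HTrivial.
Variables (R : realType) (n : nat) (S : stacky_fan n) (nxt : 'I_n -> 'I_n).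
Hypothesis hS : complete_stacky_fan R S.
Local Notation v i := (ray S i).
Local Notation D i j := (det2 (v i) (v j)).
Hypothesis det_nxt : forall i, 0 < D i (nxt i).
Hypothesis nxt_min : forall i k, 0 < D i k -> 0 <= D (nxt i) k.
Hypothesis max_cones : forall s,
  maxset (fun t => t \in fan S) s <-> exists i, s = [set i; nxt i]%SET.
Implicit Types (r m : 'rV[int]_n).

Let v_inj := ray_inj_int hS.
Let nxt_inj := nxt_det_inj v_inj det_nxt nxt_min.
Let nxt2_neq := nxt2_det_neq det_nxt.
Let nxt_connected := nxt_det_connected v_inj det_nxt nxt_min.

Lemma H_trivial_one_exit r : inhabited 'I_n -> H_trivial R S r <->
  forall m, homogeneous R S r m -> #|exits nxt (negative m)| = 1%N.
Proof.
move=> i0; pose sig i : maximal_cone S := exist _ [set i; nxt i]%SET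
  (proj2 (max_cones _) (ex_intro _ i erefl)).
have sig_surj x : exists i, x = sig i.
  have [i xi] := proj1 (max_cones (val x)) (valP x).
  by exists i; apply: val_inj.
have acP N := acyclicP (complex R) nxt_inj nxt2_neq nxt_connected
  (fun i => erefl (val (sig i))) sig_surj N i0.
rewrite H_trivial_acyclic; split=> H m /H; first by move/acP.
by move=> e; apply/acP.
Qed.

Lemma homogeneous_shift r (w : 'rV[int]_2) :
  homogeneous R S r (r + \row_i dot2 w (v i)).
Proof.
move=> z [z0 zG]; have := zG (dot2 w) => e; rewrite -[RHS]mulr1 -e /mono -big_split.
by apply: eq_bigr => i _; rewrite !mxE expfzDr.
Qed.

(* Evaluate both monomials at the point 2^y of G, where y is the linear relation
   between the rays a, b and l. *)
Lemma homogeneous_three_term r m : homogeneous R S r m ->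
  three_term (fun i => v i) (fun l => m ord0 l - r ord0 l).
Proof.
move=> hm a b l; have two : (2%:R : complex R) != 0 by rewrite pnatr_eq0.
pose y i : int := (i == a)%:R * D b l + (i == b)%:R * D l a + (i == l)%:R * D a b.
have sum_y (f : 'I_n -> int) : \sum_i y i * f i = f a * D b l + f b * D l a + f l * D a b.
  have delta (k : 'I_n) (c : int) : \sum_i (i == k)%:R * c * f i = f k * c.
    rewrite (bigD1 k) //= eqxx mul1r big1 ?addr0 1?mulrC // => i /negPf ->.
    by rewrite !mul0r.
  rewrite -!delta -!big_split; apply: eq_bigr => i _ /=.
  by rewrite /y !mulrDl.
pose z i : complex R := 2%:R ^ y i.
have prodE (f : 'I_n -> int) : \prod_i z i ^ f i = 2%:R ^ (\sum_i y i * f i).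
  rewrite (big_morph _ (fun k1 k2 => expfzDr k1 k2 two) (expr0z _)).
  by apply: eq_bigr => i _; rewrite exprz_exp.
have zG : stackG S z.
  split=> [i|w]; first by rewrite expfz_neq0.
  rewrite prodE sum_y (_ : _ + _ = 0) ?expr0z //.
  transitivity (w (D b l *: v a + D l a *: v b + D a b *: v l)).
    have wZ (k : int) (x : 'rV[int]_2) : w (k *: x) = w x * k.
      by rewrite -[k in LHS]intz scaler_int raddfMz mulrzz.
    by rewrite !raddfD /= !wZ.
  by rewrite cramer raddf0.
have := hm z zG; rewrite /mono !prodE => e.
have : (2%:R : complex R) ^ (\sum_i y i * m ord0 i - \sum_i y i * r ord0 i) == 1.
  by rewrite expfzDr // e -expfzDr // subrr expr0z.
rewrite pexprz_eq1 ?ler0n // pnatr_eq1 orbF !sum_y => /eqP <-; ring.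
Qed.

(** The bundle [-E_i] twisted by [Q] times the positive part of [det2 (v i) _], a piecewise linear
    function that breaks along the line of [v i]. *)
Definition antipodal_family i (Q : int) : 'rV[int]_n :=
  \row_l ((if 0 < D i l then Q * D i l else 0) - (l == i)%:R).

Lemma antipodal_family_H_trivial i j Q : D i j = 0 -> i != j ->
  H_trivial R S (antipodal_family i Q).
Proof.
move=> Dij ij; apply/H_trivial_one_exit => [|m hm]; first exact: (inhabits i).
have [c1 [c2 [c1_gt0 c2_gt0 vij]]] := antipodal v_inj det_nxt Dij ij.
have Dc l := @det2_antipodal _ _ _ (v l) _ _ vij.
pose q l := m ord0 l - antipodal_family i Q ord0 l.
have qP : three_term (fun l => v l) q := homogeneous_three_term hm.
have mE l : m ord0 l = q l + ((if 0 < D i l then Q * D i l else 0) - (l == i)%:R).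
  by rewrite /q mxE subrK.
have cq : c1 * q i + c2 * q j = 0.
  have : (c1 * q i + c2 * q j) * D i (nxt i) = 0.
    transitivity (q i * (c1 * D i (nxt i) + c2 * D j (nxt i)) -
      c2 * (q i * D j (nxt i) + q j * D (nxt i) i + q (nxt i) * D i j)).
      by rewrite Dij [D (nxt i) i]det2_antisym; ring.
    by rewrite Dc qP !mulr0 subrr.
  by move/eqP; rewrite mulf_eq0 [D _ _ == 0]gt_eqF // orbF => /eqP.
have q'P : three_term (fun l => v l) (fun l => q l + Q * D i l).
  move=> a b l; transitivity (q a * D b l + q b * D l a + q l * D a b).
    by rewrite /det2; ring.
  exact: qP.
have ml l : 0 < D i l -> (l \in negative m) = (q l + Q * D i l < 0).
  move=> il; rewrite inE mE il; have [e|_] := eqVneq l i; last by rewrite subr0.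
  by rewrite e det2vv ltxx in il.
have mr l : D i l < 0 -> (l \in negative m) = (q l < 0).
  move=> il; rewrite inE mE [0 < D i l]ltNge ltW //=.
  have [e|_] := eqVneq l i; last by rewrite ?subr0 ?addr0.
  by rewrite e det2vv ltxx in il.
(* The coefficient -1 at [i] makes this inequality weak. As [q i] and [q j] have opposite signs,
   exactly one of [i] and [j] is negative. *)
have mi : (i \in negative m) = (q i <= 0).
  by rewrite inE mE det2vv ltxx eqxx; lia.
have mj : (j \in negative m) = (q j < 0).
  by rewrite inE mE Dij ltxx [j == i]eq_sym (negPf ij) ?subr0 ?addr0.
(* If [q i] is positive, [j] is the negative one of the two; the roles of [i] and [j], and with them
   left and right, are exchanged. *)
have [qi|qi] := leP (q i) 0.
  apply: (@antipodal_one_exit _ _ _ v_inj det_nxt nxt_min i j c1 c2 _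
    (fun l => q l + Q * D i l) q) => //.
  - by rewrite mi.
  - by rewrite mj; nia.
  - by rewrite det2vv mulr0 addr0.
apply: (@antipodal_one_exit _ _ _ v_inj det_nxt nxt_min j i c2 c1 _
    q (fun l => q l + Q * D i l)) => //.
- by rewrite addrC.
- by rewrite mj; nia.
- by rewrite mi; lia.
- by nia.
- by rewrite Dij mulr0 addr0; nia.
- by move=> l jl; apply: mr; have := Dc l; nia.
by move=> l jl; apply: ml; have := Dc l; nia.
Qed.

Lemma pic_class_id r : pic_class S r r.
Proof.
by exists (dot2 0); apply/rowP=> l; rewrite !mxE /= /dot2 !mxE !mul0r !addr0.
Qed.

(** The difference of two members in one class is a linear form that vanishes at [i] and at [nxt j],
    to the right of the line, hence everywhere; at [nxt i] it equals [(Q - Q') * D i (nxt i)]. *)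
Lemma antipodal_family_inj i j Q Q' : D i j = 0 -> i != j ->
  pic_class S (antipodal_family i Q) = pic_class S (antipodal_family i Q') -> Q = Q'.
Proof.
move=> Dij ij e; have := pic_class_id (antipodal_family i Q); rewrite e => -[w we].
have wE l : w (v l) = antipodal_family i Q ord0 l - antipodal_family i Q' ord0 l.
  by rewrite we !mxE; ring.
have [c1 [c2 [c1_gt0 c2_gt0 vij]]] := antipodal v_inj det_nxt Dij ij.
have Dc l := @det2_antipodal _ _ _ (v l) _ _ vij.
have wZ (k : int) (x : 'rV[int]_2) : w (k *: x) = w x * k.
  by rewrite -[k in LHS]intz scaler_int raddfMz mulrzz.
have ir : D i (nxt j) < 0 by have := Dc (nxt j); have := det_nxt j; nia.
have wi : w (v i) = 0 by rewrite wE !mxE det2vv ltxx subrr.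
have wr : w (v (nxt j)) = 0 by rewrite wE !mxE [0 < D _ _]ltNge ltW //= subrr.
have : w (v (nxt i)) * D i (nxt j) = 0.
  have := congr1 w (cramer (v i) (v (nxt j)) (v (nxt i))).
  by rewrite !raddfD /= !wZ raddf0 wi wr !mul0r !add0r.
move/eqP; rewrite mulf_eq0 [D _ _ == 0]lt_eqF // orbF wE !mxE det_nxt.
rewrite opprB addrA subrK -mulrBl mulf_eq0 [D _ _ == 0]gt_eqF // orbF subr_eq0.
by move/eqP.
Qed.

Lemma antipodal_infinite i j : D i j = 0 -> i != j ->
  infinite_set (pic_class S @` [set r : 'rV[int]_n | H_trivial R S r])%classic.
Proof.
move=> Dij ij; pose f (k : nat) := pic_class S (antipodal_family i k%:Z).
move=> /(finite_preimage (f := f)) fin; apply: infinite_nat.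
apply: sub_finite_set (fin _) => [k _|k k' _ _ /(antipodal_family_inj Dij ij)[]//].
exists (antipodal_family i k%:Z) => //.
exact: antipodal_family_H_trivial Dij ij.
Qed.

Lemma bounded_rows_finite (K : 'I_n -> int) :
  finite_set [set r : 'rV[int]_n | forall l, `|r ord0 l| <= K l]%classic.
Proof.
pose B := (\sum_l absz (K l))%N.
pose g (f : {ffun 'I_n -> 'I_(2 * B).+1}) : 'rV[int]_n := \row_l ((f l)%:Z - B%:Z).
apply: sub_finite_set (finite_image g (@finite_finset _ [set: _]%classic)).
move=> r rK; exists [ffun l => inord (absz (r ord0 l + B%:Z))]; first by [].
apply/rowP=> l; rewrite mxE ffunE -[0]/(ord0 : 'I_1).
have KB : (absz (K l) <= B)%N by rewrite /B (bigD1 l) //= leq_addr.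
by move: (r ord0 l) (K l) (rK l) KB => x k xk kB; rewrite inordK; lia.
Qed.

(** Shifting by a linear form keeps the class, so each H-trivial class has a normalized
    representative, and these lie in a finite box. *)
Lemma noncollinear_finite (i0 : 'I_n) : (forall i j, i != j -> D i j != 0) ->
  finite_set (pic_class S @` [set r : 'rV[int]_n | H_trivial R S r])%classic.
Proof.
move=> D_neq0.
have /choice[K KP] := normalized_bounded v_inj det_nxt nxt_min D_neq0 i0.
apply: sub_finite_set (finite_image (pic_class S) (bounded_rows_finite K)).
move=> _ [r /= /H_trivial_one_exit -/(_ (inhabits i0)) Hr <-].
have good : always_one_exit (fun l => v l) nxt (fun l => r ord0 l).
  move=> w; apply: etrans (Hr _ (homogeneous_shift r w)).
  congr #|pred_of_set (exits nxt _)|; apply/setP=> l.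
  by rewrite !inE !mxE.
have [w wP] := normalized_shift det_nxt i0 good.
exists (r + \row_l dot2 w (v l)).
  by move=> l; have := KP l _ wP; rewrite !mxE.
apply/seteqP; split=> x [w' ->].
  exists (dot2 w \+ w').
  by apply/rowP=> l; rewrite !mxE /=; ring.
exists (w' \- dot2 w).
by apply/rowP=> l; rewrite !mxE /=; ring.
Qed.

End HTrivial.

Lemma collinear_det2_eq0 (R : realType) (v w : 'rV[int]_2) :
  collinear R v w -> det2 v w = 0.
Proof.
case=> u [_ [a [b [va wb]]]]; apply/eqP; rewrite -(intr_eq0 R) -det2_toR va wb.
by apply/eqP; rewrite /det2 !mxE; ring.
Qed.

Lemma det2_eq0_collinear (R : realType) (v w : 'rV[int]_2) :
  toR R v != 0 -> det2 w v = 0 -> collinear R v w.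
Proof.
move=> v0 wv; have vv : 0 < dot2 (toR R v) (toR R v) by rewrite dot2_gt0.
exists (toR R v); split=> //; exists 1, (dot2 (toR R w) (toR R v) / dot2 (toR R v) (toR R v)).
split; first by rewrite scale1r.
apply: (scalerI (lt0r_neq0 vv)); rewrite scalerA mulrCA divff ?lt0r_neq0 // mulr1.
by apply: det2_eq0_scale; rewrite det2_toR wv.
Qed.

Theorem theorem2p11 (R : realType) (n : nat) (S : stacky_fan n)
    (hS : complete_stacky_fan R S) :
  infinite_set (pic_class S @` [set r : 'rV[int]_n | H_trivial R S r])%classic
  <->
  exists i j : 'I_n, i <> j /\ collinear R (ray S i) (ray S j).
Proof.
have [nxt [det_nxt nxt_min max_cones]] := fan_cyclic_order hS.
split=> [|[i [j [/eqP ij /collinear_det2_eq0 Dij]]]]; last first.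
  exact: (antipodal_infinite hS det_nxt nxt_min max_cones Dij ij).
apply: contra_notP => noncol.
have [i0] := fan_nonempty hS.
apply: (noncollinear_finite hS det_nxt nxt_min max_cones i0) => i j ij.
apply/eqP=> Dij; apply: noncol; exists j, i; split; first by apply/eqP; rewrite eq_sym.
by apply: det2_eq0_collinear Dij; exact: fan_ray_neq0.
Qed.
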